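(* Let $\theta$ be a non-constant inner function and let $A$ be a bounded linear operator on $\mathcal{K}_\theta$. The identity $$A-S_\theta AS_\theta^*=\psi\otimes k_0^\theta+k_0^\theta\otimes\chi$$ holds for some $\psi,\chi\in\mathcal{K}_\theta$ if and only if the identity $$AS_\theta-S_\theta A=u\otimes\widetilde{k}_0^\theta+k_0^\theta\otimes v$$ holds for some $u,v\in\mathcal{K}_\theta$. More precisely, if the first identity holds with $\psi,\chi$, then the second holds with $u=-(S_\theta A\widetilde{k}_0^\theta+\theta(0)\psi)$ and $v=S_\theta^*\chi$; and if the second identity holds with $u,v$, then the first holds with $\psi=Ak_0^\theta-\overline{\theta(0)}\,u$ and $\chi=S_\theta v$.
   Context: $H^2\subset L^2(\mathbb{T})$ is the Hardy space of the unit circle (normalized Lebesgue measure). An inner function $\theta$ is a bounded analytic function on the unit disk with $|\theta|=1$ a.e. on $\mathbb{T}$. The model space is $\mathcal{K}_\theta=H^2\ominus\theta H^2$, $P_{\mathcal{K}_\theta}$ is the orthogonal projection of $L^2(\mathbb{T})$ onto $\mathcal{K}_\theta$, and the compressed shift is $S_\theta f=P_{\mathcal{K}_\theta}(zf)$, $f\in\mathcal{K}_\theta$. Put $k_0^\theta(z)=1-\overline{\theta(0)}\theta(z)$ and $\widetilde{k}_0^\theta(z)=\frac{\theta(z)-\theta(0)}{z}$, both in $\mathcal{K}_\theta$. $(p\otimes q)f=\langle f,q\rangle p$ (inner product linear in the first variable). *)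

(* Defs.v *)
From mathcomp Require Import all_boot all_order all_algebra.
From mathcomp Require Import all_classical all_reals all_analysis.
From mathcomp Require Export complex.

Set Implicit Arguments.
Unset Strict Implicit.
Unset Printing Implicit Defensive.
Import Order.TTheory GRing.Theory Num.Theory.
Import numFieldNormedType.Exports.

Local Open Scope classical_set_scope.
Local Open Scope ring_scope.
Local Open Scope complex_scope.

(* Functions on the unit circle are represented by functions of the angle
   t : R, of which only the values for t in [0, 2 pi] matter; the normalized
   Lebesgue measure of the circle is the uniform probability on [0, 2 pi].
   Elements of L^2 are such functions up to a.e. equality: the quotient is not
   formed, and equality in L^2 is [ae_equal]. *)

Lemma two_pi_gt0 (R : realType) : (0 : R) < 2 * pi.
Proof. by rewrite mulr_gt0 ?pi_gt0. Qed.

Section HardySpace.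
Context {R : realType}.
Local Notation C := R[i].

Definition circle_measure : probability (measurableTypeR R) R :=
  uniform_prob (two_pi_gt0 R).
Local Notation mu := circle_measure.

Definition circle_pt (t : R) : C := cos t +i* sin t.

Definition ae_equal (f g : R -> C) : Prop := {ae mu, forall t, f t = g t}.

Definition inL2 (f : R -> C) : Prop :=
  [/\ measurable_fun [set: measurableTypeR R] (fun t => complex.Re (f t)),
      measurable_fun [set: measurableTypeR R] (fun t => complex.Im (f t)) &
      (\int[mu]_t (Normc.normc (f t) ^+ 2)%:E < +oo)%E].

Definition inner (f g : R -> C) : C :=
  (\int[mu]_t complex.Re (f t * (g t)^*)) +i*
  (\int[mu]_t complex.Im (f t * (g t)^*)).

Definition L2norm (f : R -> C) : R := Num.sqrt (\int[mu]_t (Normc.normc (f t) ^+ 2)).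

Definition fourier_coef (f : R -> C) (n : int) : C :=
  inner f (fun t => circle_pt t ^ n).

Definition H2 : set (R -> C) :=
  [set f | inL2 f /\ forall n : int, n < 0 -> fourier_coef f n = 0].

(* The projection and the adjoint below select a representative of the class
   determined by their defining property (and are 0 if there is none). *)

Definition orth_proj (K : set (R -> C)) (f : R -> C) : R -> C :=
  xget (fun=> 0) [set g | K g /\ forall h, K h -> inner (f \- g) h = 0].

Definition adjoint_on (K : set (R -> C)) (T : (R -> C) -> (R -> C))
    (g : R -> C) : R -> C :=
  xget (fun=> 0)
    [set g' | K g' /\ forall f, K f -> inner (T f) g = inner f g'].

Definition bounded_linear_on (K : set (R -> C)) (T : (R -> C) -> (R -> C)) :
    Prop :=
  [/\ forall f, K f -> K (T f),
      forall f g, K f -> K g -> ae_equal f g -> ae_equal (T f) (T g),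
      forall (a : C) f g, K f -> K g ->
        ae_equal (T (fun t => a * f t + g t)) (fun t => a * T f t + T g t) &
      exists M : R, forall f, K f -> L2norm (T f) <= M * L2norm f].

Definition op_equal_on (K : set (R -> C)) (T1 T2 : (R -> C) -> (R -> C)) :
    Prop := forall f, K f -> ae_equal (T1 f) (T2 f).

Definition rank_one (p q : R -> C) (f : R -> C) : R -> C :=
  fun t => inner f q * p t.

Definition radial (theta : C -> C) (t r : R) : C^o :=
  theta (r%:C * circle_pt t).

Definition boundary (theta : C -> C) (t : R) : C :=
  lim (radial theta t r @[r --> (1 : R)^'-]).

(* Differentiation is over the field [C], hence complex differentiation. *)
Definition analytic_on_disk (theta : C -> C) : Prop :=
  forall z : C, `|z| < 1 -> derivable (theta : C^o -> C^o) z 1.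

Definition inner_function (theta : C -> C) : Prop :=
  [/\ analytic_on_disk theta,
      exists M : R, forall z : C, `|z| < 1 -> `|theta z| <= M%:C &
      {ae mu, forall t, cvg (radial theta t r @[r --> (1 : R)^'-]) /\
                        `|boundary theta t| = 1}].

Definition constant_on_disk (theta : C -> C) : Prop :=
  exists c : C, forall z : C, `|z| < 1 -> theta z = c.

Definition model_space (theta : C -> C) : set (R -> C) :=
  [set f | H2 f /\
     forall h, H2 h -> inner f (fun t => boundary theta t * h t) = 0].

Definition compressed_shift (theta : C -> C) (f : R -> C) : R -> C :=
  orth_proj (model_space theta) (fun t => circle_pt t * f t).

Definition compressed_shift_adj (theta : C -> C) : (R -> C) -> (R -> C) :=
  adjoint_on (model_space theta) (compressed_shift theta).

Definition k0 (theta : C -> C) (t : R) : C :=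
  1 - (theta 0)^* * boundary theta t.

Definition k0_tilde (theta : C -> C) (t : R) : C :=
  (boundary theta t - theta 0) / circle_pt t.

End HardySpace.

(* Main.v *)
Require Import Defs.
From mathcomp Require Import all_boot all_order all_algebra.
From mathcomp Require Import all_classical all_reals all_analysis.
From mathcomp Require Import measurable_realfun ring lra.
Set Implicit Arguments.
Unset Strict Implicit.
Unset Printing Implicit Defensive.
Import Order.TTheory GRing.Theory Num.Theory.
Import numFieldNormedType.Exports.
Import Normc.
Local Open Scope classical_set_scope.
Local Open Scope ring_scope.
Local Open Scope complex_scope.
Local Notation Re := complex.Re.
Local Notation Im := complex.Im.
(* Inside ring expressions the star already denotes Num.conj, which is conjc up
   to conversion only; this makes it do so everywhere. *)
Local Notation "z ^*" := (Num.conj z) : complex_scope.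

(** Write k~ for [k0_tilde theta], S for the compressed shift and S* for its
    adjoint. The statement is pure algebra once four relations are known:

      S* S = I - k~ (x) k~,          S S* = I - k (x) k,
      S k~ = - theta(0) k,           S* k = - conj(theta(0)) k~.

    Indeed, applying the first identity to S f replaces S A S* S f by
    S A f - <f, k~> S A k~, and <S f, k>, <S f, chi> become inner products of f
    with S* k and S* chi; applying the second identity to S* f is handled in the
    same way with S S*. This is [displacement_to_commutator] and
    [commutator_to_displacement].

    The four relations follow from the formulas

      S f = z f - <f, k~> theta,     S* f = (f - <f, k>) / z

    on the model space ([compressed_shiftE], [compressed_shift_adjE]). The
    right-hand sides lie in the model space and have the property that defines
    the projection, respectively the adjoint; elements of the model space with
    that property agree almost everywhere because <f, f> = 0 forces f = 0.

    These verifications use the inclusion of theta H2 in H2 and the equality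
    (theta h)(0) = theta(0) h(0), both contained in [fourier_coef_mul_b]. Here H2
    is described by Fourier coefficients of functions on the circle, while theta
    is a function on the disk that is known only to be complex differentiable at
    every point, bounded, and to have unimodular radial limits. The link
    is [boundary_mean_value]: on each circle of radius r < 1 the function theta is
    a uniform limit of polynomials in z with constant term theta(0), for which the
    equality is clear, and dominated convergence lets r tend to 1.

    The polynomials are the Taylor polynomials of theta, obtained from Cauchy's
    formula ([power_series_approx]). As no continuity of the derivative is
    available, the formula is proved by Goursat's subdivision argument. It is
    applied in the parameter plane (s, t) of the homotopy
    w + s (rho e^(it) - w), which shrinks the circle of radius rho to the point w
    ([circle_shrink]); the subdivision is the statement [mixed_diff_eq0] about the
    mixed differences of a function of two real variables.

    Finally, membership in L2 requires Borel measurability at all points, not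
    only almost everywhere. For the boundary function of theta it is obtained in
    [boundary_meas] by showing that the set of angles with a radial limit is
    Borel. *)

(** * Complex numbers and complex-valued integrals *)
Section ComplexNumbers.
Context {R : realType}.
Implicit Types z w : R[i].

Lemma cReD z w : Re (z + w) = Re z + Re w. Proof. by case: z; case: w. Qed.
Lemma cImD z w : Im (z + w) = Im z + Im w. Proof. by case: z; case: w. Qed.
Lemma cReN z : Re (- z) = - Re z. Proof. by case: z. Qed.
Lemma cImN z : Im (- z) = - Im z. Proof. by case: z. Qed.
Lemma cReM z w : Re (z * w) = Re z * Re w - Im z * Im w.
Proof. by case: z; case: w. Qed.
Lemma cImM z w : Im (z * w) = Re z * Im w + Im z * Re w.
Proof. by case: z; case: w. Qed.
Lemma cReJ z : Re z^* = Re z. Proof. by case: z. Qed.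
Lemma cImJ z : Im z^* = - Im z. Proof. by case: z. Qed.
Definition cReImE := (cReD, cImD, cReN, cImN, cReM, cImM, cReJ, cImJ).

Lemma complexP z w : Re z = Re w -> Im z = Im w -> z = w.
Proof. by case: z w => [a b] [c d] /= -> ->. Qed.

Lemma normr_normc z : `|z| = (normc z)%:C. Proof. by []. Qed.

Lemma normc_ge0 z : 0 <= normc z.
Proof. by case: z => a b; exact: sqrtr_ge0. Qed.

Lemma sqr_normcE z : normc z ^+ 2 = Re z ^+ 2 + Im z ^+ 2.
Proof. by case: z => a b /=; rewrite sqr_sqrtr// addr_ge0 ?sqr_ge0. Qed.

Lemma normc_conj z : normc z^* = normc z.
Proof. by case: z => a b /=; rewrite sqrrN. Qed.

Lemma mulc_conj z : z * z^* = (normc z ^+ 2)%:C.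
Proof.
by rewrite sqr_normcE; case: z => a b /=; apply: complexP; rewrite !cReImE /=; ring.
Qed.

Lemma normc_Re z : `|Re z| <= normc z.
Proof. by rewrite -lecR; exact: normc_ge_Re. Qed.

Lemma normc_Im z : `|Im z| <= normc z.
Proof.
case: z => a b /=; rewrite -sqrtr_sqr ler_wsqrtr// lerDr sqr_ge0 //.
Qed.

Lemma normc_le z : normc z <= `|Re z| + `|Im z|.
Proof.
rewrite -(@ler_pXn2r _ 2)// ?nnegrE ?normc_ge0// ?addr_ge0//.
rewrite sqr_normcE sqrrD !real_normK ?num_real//.
by rewrite lerD2r lerDl mulrn_wge0// mulr_ge0.
Qed.

Lemma normc_real (x : R) : normc x%:C = `|x|.
Proof. by rewrite /= expr0n/= addr0 sqrtr_sqr. Qed.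

Lemma normcX z n : normc (z ^+ n) = normc z ^+ n.
Proof.
by elim: n => [|n ih]; [rewrite !expr0 normc1|rewrite !exprS normcM ih].
Qed.

Lemma normcB z w : normc (z - w) = normc (w - z).
Proof. by rewrite -normcN opprB. Qed.

Lemma le_normcB z w : normc z - normc w <= normc (z - w).
Proof. by rewrite lerBlDr -{1}(subrK w z); exact: le_normcD. Qed.

Lemma conjcM z w : (z * w)^* = z^* * w^*. Proof. exact: rmorphM. Qed.
Lemma conjcD z w : (z + w)^* = z^* + w^*. Proof. exact: rmorphD. Qed.
Lemma conjcB z w : (z - w)^* = z^* - w^*. Proof. exact: rmorphB. Qed.
Lemma conjcN z : (- z)^* = - z^*. Proof. exact: rmorphN. Qed.

End ComplexNumbers.

Section ComplexIntegral.
Context d (T : measurableType d) {R : realType}.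
Variable mu : {finite_measure set T -> \bar R}.
Implicit Types f g : T -> R[i].

Definition cmeas f := measurable_fun [set: T] (fun t => Re (f t)) /\
                      measurable_fun [set: T] (fun t => Im (f t)).

Definition cintegrable f :=
  mu.-integrable [set: T] (EFin \o (fun t => Re (f t))) /\
  mu.-integrable [set: T] (EFin \o (fun t => Im (f t))).

Definition cint f : R[i] :=
  (\int[mu]_t Re (f t)) +i* (\int[mu]_t Im (f t)).

Lemma cmeas_cst c : cmeas (fun=> c).
Proof. by split; exact: measurable_cst. Qed.

Lemma cmeasD f g : cmeas f -> cmeas g -> cmeas (fun t => f t + g t).
Proof.
move=> [rf jf] [rg ig]; split.
- under eq_fun do rewrite cReD; exact: measurable_funD.
- under eq_fun do rewrite cImD; exact: measurable_funD.
Qed.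

Lemma cmeasN f : cmeas f -> cmeas (fun t => - f t).
Proof.
move=> [rf jf]; split.
- under eq_fun do rewrite cReN; exact: measurable_funN.
- under eq_fun do rewrite cImN; exact: measurable_funN.
Qed.

Lemma cmeasM f g : cmeas f -> cmeas g -> cmeas (fun t => f t * g t).
Proof.
move=> [rf jf] [rg ig]; split.
- by under eq_fun do rewrite cReM; apply: measurable_funB; exact: measurable_funM.
- by under eq_fun do rewrite cImM; apply: measurable_funD; exact: measurable_funM.
Qed.

Lemma cmeas_conj f : cmeas f -> cmeas (fun t => (f t)^*).
Proof.
move=> [rf jf]; split.
- by under eq_fun do rewrite cReJ.
- by under eq_fun do rewrite cImJ; exact: measurable_funN.
Qed.

Lemma measurable_normc2 f : cmeas f ->
  measurable_fun [set: T] (fun t => normc (f t) ^+ 2).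
Proof.
move=> [rf jf]; under eq_fun do rewrite sqr_normcE.
by apply: measurable_funD; exact: measurable_funX.
Qed.

Lemma cintegrable_meas f : cintegrable f -> cmeas f.
Proof.
by move=> [rf jf]; split; apply/measurable_EFinP;
  [exact: measurable_int rf|exact: measurable_int jf].
Qed.

Lemma cintegrable_le f (g : T -> R) : cmeas f ->
  mu.-integrable [set: T] (EFin \o g) -> (forall t, normc (f t) <= g t) ->
  cintegrable f.
Proof.
move=> [rf jf] ig fg; split.
- apply: le_integrable ig => //; first exact/measurable_EFinP.
  move=> t _ /=; rewrite lee_fin (le_trans (normc_Re _))// (le_trans (fg t))//.
  exact: ler_norm.
- apply: le_integrable ig => //; first exact/measurable_EFinP.
  move=> t _ /=; rewrite lee_fin (le_trans (normc_Im _))// (le_trans (fg t))//.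
  exact: ler_norm.
Qed.

Lemma cintegrableD f g : cintegrable f -> cintegrable g ->
  cintegrable (fun t => f t + g t).
Proof.
move=> [rf jf] [rg ig]; split.
- rewrite (_ : EFin \o _ = (EFin \o (fun t => Re (f t))) \+ (EFin \o (fun t => Re (g t)))).
    exact: integrableD.
  by apply/funext => t /=; rewrite cReD EFinD.
- rewrite (_ : EFin \o _ = (EFin \o (fun t => Im (f t))) \+ (EFin \o (fun t => Im (g t)))).
    exact: integrableD.
  by apply/funext => t /=; rewrite cImD EFinD.
Qed.

Lemma cintegrable_normc f : cintegrable f ->
  mu.-integrable [set: T] (EFin \o (fun t => `|Re (f t)| + `|Im (f t)|)).
Proof.
move=> [rf jf].
rewrite (_ : EFin \o _ = (EFin \o (Num.Def.normr \o (fun t => Re (f t)))) \+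
   (EFin \o (Num.Def.normr \o (fun t => Im (f t))))).
  by apply: integrableD => //; exact: integrable_norm.
by apply/funext => t /=; rewrite EFinD.
Qed.

Lemma cintegrable_bmul f b (M : R) : cmeas b -> (forall t, normc (b t) <= M) ->
  cintegrable f -> cintegrable (fun t => b t * f t).
Proof.
move=> mb bM fi.
apply: (@cintegrable_le _ (fun t => M * (`|Re (f t)| + `|Im (f t)|))).
- exact/cmeasM/cintegrable_meas.
- exact: (integrableZl measurableT M (cintegrable_normc fi)).
- by move=> t; rewrite normcM ler_pM ?normc_ge0// normc_le.
Qed.

Lemma cintegrableZ c f : cintegrable f -> cintegrable (fun t => c * f t).
Proof. exact: (@cintegrable_bmul _ (fun=> c) (normc c) (cmeas_cst c)). Qed.

Lemma cintegrableN f : cintegrable f -> cintegrable (fun t => - f t).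
Proof. by under eq_fun do rewrite -mulN1r; exact: cintegrableZ. Qed.

Lemma cintegrableB f g : cintegrable f -> cintegrable g ->
  cintegrable (fun t => f t - g t).
Proof. by move=> fi gi; apply: cintegrableD => //; exact: cintegrableN. Qed.

Lemma cintegrable_bounded f (M : R) : cmeas f -> (forall t, normc (f t) <= M) ->
  cintegrable f.
Proof.
move=> mf fM; apply: (@cintegrable_le _ (cst M)) => //.
exact: finite_measure_integrable_cst.
Qed.

Lemma cintD f g : cintegrable f -> cintegrable g ->
  cint (fun t => f t + g t) = cint f + cint g.
Proof.
move=> [rf jf] [rg ig]; apply: complexP; rewrite ?cReD ?cImD /=.
- by under eq_Rintegral do rewrite cReD; rewrite RintegralD.
- by under eq_Rintegral do rewrite cImD; rewrite RintegralD.
Qed.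

Lemma cint_conj f : cintegrable f -> cint (fun t => (f t)^*) = (cint f)^*.
Proof.
move=> [rf jf]; apply: complexP; rewrite ?cReJ ?cImJ /=.
- by under eq_Rintegral do rewrite cReJ.
- under eq_Rintegral do rewrite cImJ -mulN1r.
  by rewrite RintegralZl// mulN1r.
Qed.

Let integrableZ (k : R) (h : T -> R) : mu.-integrable [set: T] (EFin \o h) ->
  mu.-integrable [set: T] (EFin \o (fun t => k * h t)).
Proof.
by move=> hi; rewrite (_ : _ \o _ = (fun t => k%:E * (EFin \o h) t)%E)//; exact: integrableZl.
Qed.

Lemma cintZ c f : cintegrable f -> cint (fun t => c * f t) = c * cint f.
Proof.
move=> [rf jf]; apply: complexP; rewrite ?cReM ?cImM /=.
- under eq_Rintegral do rewrite cReM.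
  by rewrite RintegralB ?RintegralZl//; exact: integrableZ.
- under eq_Rintegral do rewrite cImM.
  by rewrite RintegralD ?RintegralZl//; exact: integrableZ.
Qed.

Lemma cintN f : cintegrable f -> cint (fun t => - f t) = - cint f.
Proof. by move=> fi; under eq_fun do rewrite -mulN1r; rewrite cintZ// mulN1r. Qed.

Lemma cintB f g : cintegrable f -> cintegrable g ->
  cint (fun t => f t - g t) = cint f - cint g.
Proof. by move=> fi gi; rewrite cintD ?cintN//; exact: cintegrableN. Qed.

Lemma cint0 : cint (fun=> 0) = 0.
Proof. by apply: complexP => /=; rewrite Rintegral_cst// mul0r. Qed.

Lemma cint_sum n (F : nat -> T -> R[i]) : (forall k, cintegrable (F k)) ->
  cintegrable (fun t => \sum_(0 <= k < n) F k t) /\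
  cint (fun t => \sum_(0 <= k < n) F k t) = \sum_(0 <= k < n) cint (F k).
Proof.
move=> Fi; elim: n => [|n [ih1 ih2]].
  rewrite big_nil; under eq_fun do rewrite big_nil.
  split; last by rewrite cint0.
  by split; exact: finite_measure_integrable_cst.
rewrite big_nat_recr//=; under eq_fun do rewrite big_nat_recr//=.
by split; [exact: cintegrableD|rewrite cintD// ih2].
Qed.

(** The factor 2 comes from estimating the real and imaginary parts separately;
    it is harmless because every use of the bound lets it tend to 0. *)
Lemma normc_cint_le f (g : T -> R) : cintegrable f ->
  mu.-integrable [set: T] (EFin \o g) -> (forall t, normc (f t) <= g t) ->
  normc (cint f) <= 2 * \int[mu]_t g t.
Proof.
move=> [rf jf] ig fg; rewrite (le_trans (normc_le _))// mulr2n mulrDl !mul1r/=.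
apply: lerD; apply: (le_trans (le_normr_Rintegral _ _)) => //.
- apply: le_Rintegral => //; first exact: integrable_norm.
  by move=> t _; exact: le_trans (normc_Re _) (fg t).
- apply: le_Rintegral => //; first exact: integrable_norm.
  by move=> t _; exact: le_trans (normc_Im _) (fg t).
Qed.

Lemma cint_ae f g : cmeas f -> cmeas g -> {ae mu, forall t, f t = g t} ->
  cint f = cint g.
Proof.
move=> [rf jf] [rg ig] fg; apply: complexP => /=; congr fine;
  apply: ae_eq_integral => //; try exact/measurable_EFinP.
- by apply: filterS fg => t /= -> _.
- by apply: filterS fg => t /= -> _.
Qed.

End ComplexIntegral.

(** * Square-integrable functions on the circle *)
Section L2.
Context {R : realType}.
Notation mu := (@circle_measure R).
Implicit Types f g h : R -> R[i].
Local Notation TR := (measurableTypeR R).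

Lemma ae_imply (P Q : R -> Prop) : (forall t, P t -> Q t) ->
  {ae mu, forall t, P t} -> {ae mu, forall t, Q t}.
Proof. by move=> PQ; apply: (@filterS _ _ (ae_filter_ringOfSetsType mu)). Qed.

Lemma ae_imply2 (P P' Q : R -> Prop) : (forall t, P t -> P' t -> Q t) ->
  {ae mu, forall t, P t} -> {ae mu, forall t, P' t} -> {ae mu, forall t, Q t}.
Proof. by move=> PQ; apply: (@filterS2 _ _ (ae_filter_ringOfSetsType mu)). Qed.

Lemma circle_integral_cst (c : R) : \int[mu]_(t in [set: TR]) c = c.
Proof.
rewrite Rintegral_cst// [X in _ * X](_ : _ = 1) ?mulr1//.
by rewrite [X in fine X](_ : _ = 1%E)//; exact: probability_setT.
Qed.

Lemma inL2P f : inL2 f <-> @cmeas _ TR _ f /\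
  mu.-integrable [set: TR] (EFin \o (fun t => normc (f t) ^+ 2)).
Proof.
split=> [[rf jf fi]|[[rf jf] /integrableP[_ fi]]].
  split=> //; apply/integrableP; split.
    by apply/measurable_EFinP; exact: measurable_normc2.
  apply: le_lt_trans fi; rewrite le_eqVlt; apply/orP; left; apply/eqP.
  by apply: eq_integral => t _ /=; rewrite ger0_norm ?sqr_ge0.
split => //; apply: le_lt_trans fi.
rewrite le_eqVlt; apply/orP; left; apply/eqP.
by apply: eq_integral => t _ /=; rewrite ger0_norm ?sqr_ge0.
Qed.

Lemma inL2_le f (g : R -> R) : @cmeas _ TR _ f ->
  mu.-integrable [set: TR] (EFin \o g) ->
  (forall t, normc (f t) ^+ 2 <= g t) -> inL2 f.
Proof.
move=> mf ig fg; apply/inL2P; split=> //.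
apply: le_integrable ig => //.
  by apply/measurable_EFinP; exact: measurable_normc2.
move=> t _ /=; rewrite lee_fin ger0_norm ?sqr_ge0// (le_trans (fg t))//.
exact: ler_norm.
Qed.

Let intZ (k : R) (h : R -> R) : mu.-integrable [set: TR] (EFin \o h) ->
  mu.-integrable [set: TR] (EFin \o (fun t => k * h t)).
Proof. by move=> hi; exact: (integrableZl measurableT k hi). Qed.

Let intD (h k : R -> R) : mu.-integrable [set: TR] (EFin \o h) ->
  mu.-integrable [set: TR] (EFin \o k) ->
  mu.-integrable [set: TR] (EFin \o (fun t => h t + k t)).
Proof. by move=> hi ki; exact: (integrableD measurableT hi ki). Qed.

Lemma inL2D f g : inL2 f -> inL2 g -> inL2 (fun t => f t + g t).
Proof.
move=> /inL2P[mf fi] /inL2P[mg gi].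
apply: (inL2_le (cmeasD mf mg) (intD (intZ 2 fi) (intZ 2 gi))) => t.
have := le_normcD (f t) (g t); have := normc_ge0 (f t + g t).
move: (normc _) (normc (f t)) (normc (g t)) => c a b c0 cab.
have : c ^+ 2 <= (a + b) ^+ 2 by rewrite !expr2; exact: ler_pM.
have := sqr_ge0 (a - b); nra.
Qed.

Lemma inL2_bmul b f (M : R) : @cmeas _ TR _ b -> (forall t, normc (b t) <= M) ->
  inL2 f -> inL2 (fun t => b t * f t).
Proof.
move=> mb bM /inL2P[mf fi].
apply: (inL2_le (cmeasM mb mf) (intZ (M ^+ 2) fi)) => t.
by rewrite normcM exprMn ler_wpM2r ?sqr_ge0// lerXn2r ?nnegrE ?normc_ge0//
   (le_trans _ (bM t)) ?normc_ge0.
Qed.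

Lemma inL2Z c f : inL2 f -> inL2 (fun t => c * f t).
Proof.
apply: (@inL2_bmul (fun=> c) f (normc c)); first exact: cmeas_cst.
by [].
Qed.

Lemma inL2N f : inL2 f -> inL2 (fun t => - f t).
Proof. by under eq_fun do rewrite -mulN1r; exact: inL2Z. Qed.

Lemma inL2B f g : inL2 f -> inL2 g -> inL2 (fun t => f t - g t).
Proof. by move=> fi gi; apply: inL2D => //; exact: inL2N. Qed.

Lemma inL2_bounded f (M : R) : @cmeas _ TR _ f -> (forall t, normc (f t) <= M) ->
  inL2 f.
Proof.
move=> mf fM.
have c : mu.-integrable [set: TR] (EFin \o cst (M ^+ 2)).
  exact: finite_measure_integrable_cst.
apply: (inL2_le mf c) => t /=.
by rewrite lerXn2r ?nnegrE ?normc_ge0// (le_trans _ (fM t)) ?normc_ge0.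
Qed.

Lemma inL2_cst (c : R[i]) : inL2 (fun _ : R => c).
Proof. by apply: (@inL2_bounded _ (normc c)) => //; exact: cmeas_cst. Qed.

(** Elementary case of Hoelder's inequality: |fg| <= |f|^2 + |g|^2. *)
Lemma inL2_mul f g : inL2 f -> inL2 g -> cintegrable mu (fun t => f t * g t).
Proof.
move=> /inL2P[mf fi] /inL2P[mg gi].
apply: (cintegrable_le (cmeasM mf mg) (intD fi gi)) => t.
rewrite normcM; have := normc_ge0 (f t); have := normc_ge0 (g t).
move: (normc (f t)) (normc (g t)) => a b a0 b0; have := sqr_ge0 (a - b); nra.
Qed.

Lemma inL2_conj f : inL2 f -> inL2 (fun t => (f t)^*).
Proof.
move=> /inL2P[mf fi]; apply: (inL2_le (cmeas_conj mf) fi) => t.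
by rewrite normc_conj.
Qed.

Lemma inL2_cintegrable f : inL2 f -> cintegrable mu f.
Proof.
by move=> fi; have := inL2_mul fi (inL2_cst 1); under eq_fun do rewrite mulr1.
Qed.

Lemma inL2_inner f g : inL2 f -> inL2 g -> cintegrable mu (fun t => f t * (g t)^*).
Proof. by move=> fi gi; apply: inL2_mul => //; exact: inL2_conj. Qed.

Lemma innerE f g : inner f g = cint mu (fun t => f t * (g t)^*).
Proof. by []. Qed.

Lemma innerDl f g h : inL2 f -> inL2 g -> inL2 h ->
  inner (fun t => f t + g t) h = inner f h + inner g h.
Proof.
move=> fi gi hi; rewrite !innerE -cintD//; [|exact: inL2_inner..].
by congr cint; apply/funext => t; rewrite mulrDl.
Qed.

Lemma innerZl c f h : inL2 f -> inL2 h ->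
  inner (fun t => c * f t) h = c * inner f h.
Proof.
move=> fi hi; rewrite !innerE -cintZ//; last exact: inL2_inner.
by congr cint; apply/funext => t; rewrite mulrA.
Qed.

Lemma innerNl f h : inL2 f -> inL2 h ->
  inner (fun t => - f t) h = - inner f h.
Proof.
by move=> fi hi; under eq_fun do rewrite -mulN1r; rewrite innerZl// mulN1r.
Qed.

Lemma innerBl f g h : inL2 f -> inL2 g -> inL2 h ->
  inner (fun t => f t - g t) h = inner f h - inner g h.
Proof. by move=> fi gi hi; rewrite innerDl ?innerNl//; exact: inL2N. Qed.

Lemma inner_conj f g : inL2 f -> inL2 g -> inner g f = (inner f g)^*.
Proof.
move=> fi gi; rewrite !innerE -cint_conj; last exact: inL2_inner.
by congr cint; apply/funext => t /=; rewrite conjcM conjCK mulrC.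
Qed.

Lemma innerDr f g h : inL2 f -> inL2 g -> inL2 h ->
  inner h (fun t => f t + g t) = inner h f + inner h g.
Proof.
move=> fi gi hi; rewrite inner_conj//; last exact: inL2D.
by rewrite innerDl// conjcD -!inner_conj.
Qed.

Lemma innerZr c f h : inL2 f -> inL2 h ->
  inner h (fun t => c * f t) = c^* * inner h f.
Proof.
move=> fi hi; rewrite inner_conj//; last exact: inL2Z.
by rewrite innerZl// conjcM -!inner_conj.
Qed.

Lemma innerBr f g h : inL2 f -> inL2 g -> inL2 h ->
  inner h (fun t => f t - g t) = inner h f - inner h g.
Proof.
move=> fi gi hi; rewrite inner_conj//; last exact: inL2B.
by rewrite innerBl// conjcB -!inner_conj.
Qed.

Lemma ae_equal_refl f : ae_equal f f.
Proof. exact: aeW. Qed.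

Lemma ae_equal_sym f g : ae_equal f g -> ae_equal g f.
Proof. by apply: ae_imply => t /= ->. Qed.

Lemma ae_equal_trans f g h : ae_equal f g -> ae_equal g h -> ae_equal f h.
Proof. by apply: ae_imply2 => t /= -> ->. Qed.

Lemma ae_equalB f f' g g' : ae_equal f f' -> ae_equal g g' ->
  ae_equal (fun t => f t - g t) (fun t => f' t - g' t).
Proof. by apply: ae_imply2 => t /= -> ->. Qed.

Lemma ae_equalM b f g : ae_equal f g ->
  ae_equal (fun t => b t * f t) (fun t => b t * g t).
Proof. by apply: ae_imply => t /= ->. Qed.

Lemma inner_ael f g h : inL2 f -> inL2 g -> inL2 h -> ae_equal f g ->
  inner f h = inner g h.
Proof.
move=> fi gi hi fg; apply: cint_ae.
- exact: cintegrable_meas (inL2_inner fi hi).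
- exact: cintegrable_meas (inL2_inner gi hi).
- by apply: (ae_imply _ fg) => t /= ->.
Qed.

Lemma inner_aer f g h : inL2 f -> inL2 g -> inL2 h -> ae_equal f g ->
  inner h f = inner h g.
Proof.
by move=> fi gi hi fg; rewrite inner_conj// [RHS]inner_conj// (inner_ael fi gi hi fg).
Qed.

Lemma inner_definite f : inL2 f -> inner f f = 0 -> ae_equal f (fun=> 0).
Proof.
move=> fi; rewrite innerE.
have fiff := inL2_inner fi fi.
move/(congr1 (@complex.Re R)) => /= ff0.
move: ff0; under eq_Rintegral do rewrite mulc_conj/=.
have /inL2P[mf ffi] := fi.
move=> ff0.
have {}ff0 : (\int[mu]_t `|(normc (f t) ^+ 2)%:E| = 0)%E.
  rewrite -[RHS]/(0%R%:E) -ff0 /Rintegral fineK; last exact: integrable_fin_num.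
  by apply: eq_integral => t _ /=; rewrite ger0_norm ?sqr_ge0.
have mn : measurable_fun [set: TR] (fun t => (normc (f t) ^+ 2)%:E).
  by apply/measurable_EFinP; exact: measurable_normc2.
have /ae_eq_integral_abs := ff0.
move=> /(_ measurableT mn); apply: ae_imply => t /(_ Logic.I) /= [/eqP].
by rewrite sqrf_eq0 => /eqP /eq0_normc.
Qed.
End L2.

(** * Calculus of complex-valued functions of a real variable *)
Section ComplexCalculus.
Context {R : realType}.
Implicit Types f g F G : R -> R[i].

Definition ccont f := continuous (fun t => Re (f t)) /\ continuous (fun t => Im (f t)).

Definition cderiv F (t : R) (z : R[i]) :=
  is_derive t (1 : R) (fun s => Re (F s)) (Re z) /\
  is_derive t (1 : R) (fun s => Im (F s)) (Im z).

(** The epsilon-delta form is what composes with complex differentiability; the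
    componentwise form reduces sums and products to real functions. *)
Lemma ccontP f : ccont f <-> forall t e, 0 < e ->
  exists2 d, 0 < d & forall s, `|s - t| < d -> normc (f s - f t) <= e.
Proof.
split=> [[cr ci] t e e0|fe].
  have e2 : 0 < e / 2 by rewrite divr_gt0.
  have /cvgrPdist_lt /(_ _ e2) := cr t; have /cvgrPdist_lt /(_ _ e2) := ci t.
  move=> /nbhs_ballP[d1 /= d1_gt0 H1] /nbhs_ballP[d2 /= d2_gt0 H2].
  exists (Num.min d1 d2); first by rewrite lt_min d1_gt0.
  move=> s; rewrite lt_min distrC => /andP[/H1 /= h1 /H2 /= h2].
  rewrite (le_trans (normc_le _))// !cReImE (splitr e) lerD//.
    by rewrite distrC ltW.
  by rewrite distrC ltW.
have aux (p : R[i] -> R) : (forall z w, p (z - w) = p z - p w) ->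
  (forall z, `|p z| <= normc z) -> continuous (fun t => p (f t)).
  move=> pB pn t; apply/cvgrPdist_le => e /(fe t)[d d0 H].
  apply/nbhs_ballP; exists d => //= s; rewrite /ball /= distrC => /H ?.
  by rewrite distrC -pB (le_trans (pn _)).
by split; apply: aux => [z w|z]; rewrite ?cReImE//; [exact: normc_Re|exact: normc_Im].
Qed.

Lemma ccont_meas f : ccont f -> @cmeas _ (measurableTypeR R) _ f.
Proof. by move=> [cr ci]; split; exact: continuous_measurable_fun. Qed.

Lemma ccont_cst (c : R[i]) : ccont (fun=> c).
Proof. by split=> t; exact: cvg_cst. Qed.

Lemma ccontD f g : ccont f -> ccont g -> ccont (fun t => f t + g t).
Proof.
move=> [rf jf] [rg ig]; split => t.
- by under eq_fun do rewrite cReD; apply: cvgD; [exact: rf|exact: rg].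
- by under eq_fun do rewrite cImD; apply: cvgD; [exact: jf|exact: ig].
Qed.

Lemma ccontM f g : ccont f -> ccont g -> ccont (fun t => f t * g t).
Proof.
move=> [rf jf] [rg ig]; split => t.
- under eq_fun do rewrite cReM; apply: cvgB; apply: cvgM;
    [exact: rf|exact: rg|exact: jf|exact: ig].
- under eq_fun do rewrite cImM; apply: cvgD; apply: cvgM;
    [exact: rf|exact: ig|exact: jf|exact: rg].
Qed.

Lemma ccontX f n : ccont f -> ccont (fun t => f t ^+ n).
Proof.
move=> fc; elim: n => [|n ih]; first by under eq_fun do rewrite expr0; exact: ccont_cst.
by under eq_fun do rewrite exprS; exact: ccontM.
Qed.

Lemma cderivD F G t z w : cderiv F t z -> cderiv G t w ->
  cderiv (fun s => F s + G s) t (z + w).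
Proof.
move=> [rF iF] [rG iG]; split; rewrite cReImE.
- rewrite [X in is_derive _ _ X](_ : _ = (fun s => Re (F s)) + (fun s => Re (G s))).
    exact: is_deriveD.
  by apply/funext => s; rewrite cReD.
- rewrite [X in is_derive _ _ X](_ : _ = (fun s => Im (F s)) + (fun s => Im (G s))).
    exact: is_deriveD.
  by apply/funext => s; rewrite cImD.
Qed.

Lemma cderivZ c F t z : cderiv F t z -> cderiv (fun s => c * F s) t (c * z).
Proof.
move=> [rF iF]; split; rewrite cReImE.
- rewrite [X in is_derive _ _ X](_ : _ = Re c *: (fun s => Re (F s)) -
     Im c *: (fun s => Im (F s))).
    exact: is_deriveB.
  by apply/funext => s; rewrite cReM.
- rewrite [X in is_derive _ _ X](_ : _ = Re c *: (fun s => Im (F s)) +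
     Im c *: (fun s => Re (F s))).
    exact: is_deriveD.
  by apply/funext => s; rewrite cImM.
Qed.

Lemma cderivB F G t z w : cderiv F t z -> cderiv G t w ->
  cderiv (fun s => F s - G s) t (z - w).
Proof.
move=> FF GG; under eq_fun do rewrite -mulN1r; rewrite -(mulN1r w).
by apply: cderivD => //; exact: cderivZ.
Qed.

Lemma cderiv_real t : cderiv (fun s => s%:C) t 1.
Proof. by split => /=; [exact: is_derive_id|exact: is_derive_cst]. Qed.

Let cderiv_cont_Re F t z : cderiv F t z -> {for t, continuous (fun s => Re (F s))}.
Proof. by move=> [[/derivable1_diffP/differentiable_continuous]]. Qed.
Let cderiv_cont_Im F t z : cderiv F t z -> {for t, continuous (fun s => Im (F s))}.
Proof. by move=> [_ [/derivable1_diffP/differentiable_continuous]]. Qed.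

(** The mean value theorem applied to both components, whence the factor 2. *)
Lemma cderiv_increment_le F f (a b M : R) : a <= b ->
  (forall t, a <= t <= b -> cderiv F t (f t)) ->
  (forall t, a <= t <= b -> normc (f t) <= M) ->
  normc (F b - F a) <= 2 * (M * (b - a)).
Proof.
move=> ab Ff fM; rewrite (le_trans (normc_le _))// mulr2n mulrDl !mul1r !cReImE.
have itv x : x \in `]a, b[ -> a <= x <= b.
  by rewrite in_itv/= => /andP[/ltW-> /ltW->].
apply: lerD.
- have [||c + ->] := @MVT_segment _ (fun t => Re (F t)) (fun t => Re (f t)) a b ab.
  + by move=> x /itv /Ff[].
  + apply: continuous_in_subspaceT => x; rewrite inE/= in_itv/=.
    by move=> /Ff /cderiv_cont_Re.
  rewrite in_itv/= => /fM cM; rewrite normrM (ger0_norm (_ : 0 <= b - a)) ?subr_ge0//.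
  by rewrite ler_wpM2r ?subr_ge0// (le_trans (normc_Re _)).
- have [||c + ->] := @MVT_segment _ (fun t => Im (F t)) (fun t => Im (f t)) a b ab.
  + by move=> x /itv /Ff[].
  + apply: continuous_in_subspaceT => x; rewrite inE/= in_itv/=.
    by move=> /Ff /cderiv_cont_Im.
  rewrite in_itv/= => /fM cM; rewrite normrM (ger0_norm (_ : 0 <= b - a)) ?subr_ge0//.
  by rewrite ler_wpM2r ?subr_ge0// (le_trans (normc_Im _)).
Qed.

Let ex_primitive_real (f : R -> R) (a b : R) : a < b -> continuous f ->
  exists F : R -> R, forall t, a < t < b -> is_derive t (1 : R) F (f t).
Proof.
move=> ab cf; exists (fun x => (\int[lebesgue_measure]_(t in `[a, x]) f t)%R).
move=> t /andP[at_ tb].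
have fi : lebesgue_measure.-integrable `[a, b] (EFin \o f).
  by apply: continuous_compact_integrable;
    [exact: segment_compact|exact: continuous_subspaceT].
have [dF F'] := continuous_FTC1_closed tb fi at_ (cf t).
by apply: DeriveDef; [exact: dF|rewrite -derive1E; exact: F'].
Qed.

Lemma ex_primitive f (a b : R) : a < b -> ccont f ->
  exists F, forall t, a < t < b -> cderiv F t (f t).
Proof.
move=> ab [cr ci]; have [F1 F1'] := ex_primitive_real ab cr.
have [F2 F2'] := ex_primitive_real ab ci.
by exists (fun t => F1 t +i* F2 t) => t tab; split; [exact: F1'|exact: F2'].
Qed.

Let circle_integral_primitive_real (f F : R -> R) (M : R) : continuous f ->
  (forall t, `|f t| <= M) ->
  (forall t, 0 <= t <= 2 * pi -> is_derive t (1 : R) F (f t)) ->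
  \int[circle_measure]_t f t = (2 * pi)^-1 * (F (2 * pi) - F 0).
Proof.
move=> cf fM F'.
have pi0 := two_pi_gt0 R.
have fi : circle_measure.-integrable [set: measurableTypeR R] (EFin \o f).
  apply: measurable_bounded_integrable => //.
  - by rewrite (le_lt_trans (probability_le1 _ _))// ltry.
  - exact: continuous_measurable_fun.
  - by exists M; split; [exact: num_real|move=> x Mx t _ /=; rewrite (le_trans (fM t))// ltW].
have ci : circle_measure.-integrable [set: measurableTypeR R] (EFin \o cst M).
  exact: finite_measure_integrable_cst.
(* The shift by M makes the integrand nonnegative, as integral_uniform requires. *)
suff : \int[circle_measure]_t (f t + M) = (2 * pi)^-1 * (F (2 * pi) - F 0) + M.
  by rewrite RintegralD// circle_integral_cst => /addIr.
rewrite /Rintegral integral_uniform/=; last 2 first.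
- apply/measurable_EFinP; apply: measurable_funD => //.
  exact: continuous_measurable_fun.
- by move=> t; rewrite lee_fin; have := fM t; rewrite ler_norml; lra.
have FM' t : 0 <= t <= 2 * pi -> is_derive t (1 : R) (fun s => F s + M * s) (f t + M).
  move=> /F' F't; have MD : is_derive t (1 : R) (fun s => M * s) M.
    have := is_deriveZ M (is_derive_id t (1 : R)); by rewrite /GRing.scale/= mulr1.
  exact: is_deriveD F't MD.
have FMc t : 0 <= t <= 2 * pi -> {for t, continuous (fun s => F s + M * s)}.
  by move=> /FM'[/derivable1_diffP/differentiable_continuous].
rewrite (@continuous_FTC2 _ _ (fun s => F s + M * s))//; last 3 first.
- by apply: continuous_subspaceT => t; apply: cvgD; [exact: cf|exact: cvg_cst].
- split.
  + move=> t; rewrite in_itv/= => /andP[/ltW t0 /ltW t1].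
    by have [|] := FM' t; rewrite ?t0.
  + by apply: cvg_at_right_filter; apply: FMc; rewrite lexx ltW.
  + by apply: cvg_at_left_filter; apply: FMc; rewrite lexx ltW.
- move=> t; rewrite in_itv/= => /andP[/ltW t0 /ltW t1].
  by have [|_ <-] := FM' t; rewrite ?t0// derive1E.
rewrite -EFinB -EFinM /= subr0 mulr0 addr0.
by have /negbT := gt_eqF pi0; move: (2 * pi) => p p0; field.
Qed.

(** The fundamental theorem of calculus on [0, 2 pi], for the normalized measure
    of the circle: the only place where its density enters. *)
Lemma circle_integral_primitive f F (M : R) : ccont f ->
  (forall t, normc (f t) <= M) ->
  (forall t, 0 <= t <= 2 * pi -> cderiv F t (f t)) ->
  cint circle_measure f = (2 * pi)^-1%:C * (F (2 * pi) - F 0).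
Proof.
move=> [cr ci] fM F'; apply: complexP; rewrite !cReImE /= mul0r ?subr0 ?addr0.
- apply: (@circle_integral_primitive_real _ (fun t => Re (F t)) M cr) => [t|t /F'[]//].
  exact: le_trans (normc_Re _) (fM t).
- apply: (@circle_integral_primitive_real _ (fun t => Im (F t)) M ci) => [t|t /F'[]//].
  exact: le_trans (normc_Im _) (fM t).
Qed.

End ComplexCalculus.

(** * Goursat subdivision *)
Section MixedDifference.
Context {R : realType}.
Implicit Types (W : R -> R -> R[i]).

(** For W s t = V s t - H t s, with V s and H t primitives along the vertical and
    horizontal lines of a form, this is its integral around the boundary of
    the rectangle; it is additive under subdivision whatever W is. *)
Definition mixed_diff W (s1 s2 t1 t2 : R) : R[i] :=
  W s2 t2 - W s2 t1 - W s1 t2 + W s1 t1.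

(** The mixed differences of the four quarters add up to that of the rectangle. *)
Lemma mixed_diff_quarter W (s t h k : R) : 0 <= h -> 0 <= k ->
  exists x : R * R, [/\ s <= x.1 <= s + h / 2, t <= x.2 <= t + k / 2 &
    normc (mixed_diff W s (s + h) t (t + k)) <=
    4 * normc (mixed_diff W x.1 (x.1 + h / 2) x.2 (x.2 + k / 2))].
Proof.
move=> h0 k0; pose D x y := normc (mixed_diff W x (x + h / 2) y (y + k / 2)).
have h2 : s + h / 2 + h / 2 = s + h by field.
have k2 : t + k / 2 + k / 2 = t + k by field.
have Dle : normc (mixed_diff W s (s + h) t (t + k)) <=
    D s t + D (s + h / 2) t + D s (t + k / 2) + D (s + h / 2) (t + k / 2).
  rewrite /D h2 k2.
  rewrite (_ : mixed_diff W s (s + h) t (t + k) =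
    mixed_diff W s (s + h / 2) t (t + k / 2) +
    mixed_diff W (s + h / 2) (s + h) t (t + k / 2) +
    mixed_diff W s (s + h / 2) (t + k / 2) (t + k) +
    mixed_diff W (s + h / 2) (s + h) (t + k / 2) (t + k)).
    by do 3 apply: (le_trans (le_normcD _ _)) (lerD _ (lexx _)).
  by rewrite /mixed_diff; ring.
apply: contrapT => /forallNP nD.
have in1 : s <= s <= s + h / 2 by rewrite lexx lerDl divr_ge0.
have in2 : s <= s + h / 2 <= s + h / 2 by rewrite lexx lerDl divr_ge0.
have in3 : t <= t <= t + k / 2 by rewrite lexx lerDl divr_ge0.
have in4 : t <= t + k / 2 <= t + k / 2 by rewrite lexx lerDl divr_ge0.
have lt x y : s <= x <= s + h / 2 -> t <= y <= t + k / 2 ->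
    4 * D x y < normc (mixed_diff W s (s + h) t (t + k)).
  by move=> sx ty; rewrite ltNge; apply/negP => le; apply: (nD (x, y)).
have := lt _ _ in1 in3; have := lt _ _ in2 in3.
have := lt _ _ in1 in4; have := lt _ _ in2 in4; lra.
Qed.

Lemma nested_point (s e : nat -> R) :
  (forall n, s n <= s n.+1) -> (forall n, e n.+1 <= e n) ->
  (forall n, s n <= e n) -> exists p, forall n, s n <= p <= e n.
Proof.
move=> s_nd e_ni se.
have sm m n : (m <= n)%N -> s m <= s n.
  exact: (homo_leq (@lexx _ _) (@le_trans _ _)).
have em m n : (m <= n)%N -> e n <= e m.
  by apply: (homo_leq (r := fun x y => y <= x)) => // y x z yx zy; exact: le_trans yx.
have ub m : ubound (range s) (e m).
  move=> _ [n _ <-]; rewrite (le_trans (sm n (maxn m n) _)) ?leq_maxr//.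
  by rewrite (le_trans (se _))// em// leq_maxl.
exists (sup (range s)) => n; apply/andP; split.
  by apply: ub_le_sup; [exists (e 0%N); exact: ub|exists n].
by apply: ge_sup; [exists (s 0%N); exists 0%N|exact: ub].
Qed.

(** Goursat's argument. If the mixed difference is D, the subdivision gives nested
    rectangles of size 2^-n with mixed difference at least D / 4^n; near their
    common point it is also at most e times the square of the size, that is, a
    constant times e / 4^n, so that D = 0. *)
Lemma mixed_diff_eq0 W (a b c d : R) : a <= b -> c <= d ->
  (forall p q, a <= p <= b -> c <= q <= d -> forall e, 0 < e ->
    exists2 dl, 0 < dl & forall s1 s2 t1 t2,
      a <= s1 -> s1 <= p <= s2 -> s2 <= b -> c <= t1 -> t1 <= q <= t2 -> t2 <= d ->
      s2 - s1 < dl -> t2 - t1 < dl ->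
      normc (mixed_diff W s1 s2 t1 t2) <= e * (s2 - s1 + (t2 - t1)) ^+ 2) ->
  mixed_diff W a b c d = 0.
Proof.
move=> ab cd loc.
pose h n : R := (b - a) / 2 ^+ n; pose k n : R := (d - c) / 2 ^+ n.
have h_ge0 n : 0 <= h n by rewrite divr_ge0 ?subr_ge0// exprn_ge0.
have k_ge0 n : 0 <= k n by rewrite divr_ge0 ?subr_ge0// exprn_ge0.
have hS n : h n.+1 = h n / 2 by rewrite /h exprSr invfM mulrA.
have kS n : k n.+1 = k n / 2 by rewrite /k exprSr invfM mulrA.
have /choice[f fP] (nx : nat * (R * R)) :=
  mixed_diff_quarter W nx.2.1 nx.2.2 (h_ge0 nx.1) (k_ge0 nx.1).
pose u := fix u n := if n is m.+1 then f (m, u m) else (a, c).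
have uS n : u n.+1 = f (n, u n) by [].
pose E n := normc (mixed_diff W (u n).1 ((u n).1 + h n) (u n).2 ((u n).2 + k n)).
have EE n : E 0%N <= 4 ^+ n * E n.
  elim: n => [|n ih]; first by rewrite expr0 mul1r.
  rewrite (le_trans ih)// exprSr -mulrA ler_wpM2l ?exprn_ge0//.
  by have [_ _] := fP (n, u n); rewrite -hS -kS -uS.
have step n : [/\ (u n).1 <= (u n.+1).1, (u n.+1).1 + h n.+1 <= (u n).1 + h n,
    (u n).2 <= (u n.+1).2 & (u n.+1).2 + k n.+1 <= (u n).2 + k n].
  have [/= + + _] := fP (n, u n); rewrite -uS hS kS.
  by move=> /andP[-> +] /andP[-> +]; split => //; lra.
have [p pP] : exists p, forall n, (u n).1 <= p <= (u n).1 + h n.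
  by apply: nested_point => n; [case: (step n)..|rewrite lerDl].
have [q qP] : exists q, forall n, (u n).2 <= q <= (u n).2 + k n.
  by apply: nested_point => n; [case: (step n)..|rewrite lerDl].
have box n : [/\ a <= (u n).1, (u n).1 + h n <= b, c <= (u n).2 & (u n).2 + k n <= d].
  elim: n => [|n [? ? ? ?]]; first by rewrite /h /k expr0 !divr1 /= !lexx; split => //; lra.
  by have [? ? ? ?] := step n; split; lra.
have pab : a <= p <= b by have := pP 0%N; rewrite /h expr0 divr1 /= addrC subrK.
have qcd : c <= q <= d by have := qP 0%N; rewrite /k expr0 divr1 /= addrC subrK.
have E0 e : 0 < e -> E 0%N <= e * (b - a + (d - c)) ^+ 2.
  move=> /(loc p q pab qcd)[dl dl0 H].
  have [n [hn kn]] : exists n, h n < dl /\ k n < dl.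
    have cvgh (x : R) : (fun n => x / 2 ^+ n) @ \oo --> 0.
      rewrite -(mulr0 x); apply: cvgM; first exact: cvg_cst.
      rewrite (_ : (fun n => (2 ^+ n)^-1) = (fun n => (2^-1) ^+ n)); last first.
        by apply/funext => n; rewrite exprVn.
      by apply: cvg_expr; rewrite ger0_norm// invf_lt1// ltr1n.
    have /cvgrPdist_lt/(_ _ dl0)[N1 _ H1] := cvgh (b - a).
    have /cvgrPdist_lt/(_ _ dl0)[N2 _ H2] := cvgh (d - c).
    exists (maxn N1 N2); split.
      have : `|0 - h (maxn N1 N2)| < dl := H1 (maxn N1 N2) (leq_maxl _ _).
      by rewrite sub0r normrN ger0_norm.
    have : `|0 - k (maxn N1 N2)| < dl := H2 (maxn N1 N2) (leq_maxr _ _).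
    by rewrite sub0r normrN ger0_norm.
  have [? ? ? ?] := box n.
  rewrite (le_trans (EE n))//.
  have := H (u n).1 ((u n).1 + h n) (u n).2 ((u n).2 + k n).
  rewrite ![_ + _ - _]addrAC !subrr !add0r => /(_ _ (pP n) _ _ (qP n)).
  move=> /(_ _ _ _ _ hn kn) En.
  rewrite (@le_trans _ _ (4 ^+ n * (e * (h n + k n) ^+ 2)))//.
    by rewrite ler_wpM2l ?exprn_ge0//; exact: En.
  rewrite /h /k -mulrDl exprMn -exprVn -exprM mulnC exprM mulrCA (mulrC (4 ^+ n)) -!mulrA -exprMn.
  by rewrite (_ : 2^-1 ^+ 2 * 4 = 1 :> R) ?expr1n ?mulr1//; field.
apply: eq0_normc; apply/eqP; rewrite eq_le normc_ge0 andbT.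
have -> : normc (mixed_diff W a b c d) = E 0%N.
  by rewrite /E /h /k expr0 !divr1 /= ![_ + (_ - _)]addrC !subrK.
apply/ler_addgt0Pr => e e0; rewrite add0r.
set L := (b - a + (d - c)) ^+ 2 in E0.
have L0 : 0 <= L by exact: sqr_ge0.
rewrite (le_trans (E0 (e / (L + 1)) _)) ?divr_gt0 ?ltr_wpDl//.
rewrite -mulrA ger_pMr// mulrC ler_pdivrMr ?ltr_wpDl// mul1r; lra.
Qed.

End MixedDifference.

(** * Complex differentiability and powers of z on the circle *)
Section Differentiability.
Context {R : realType}.
Local Notation C := (R[i]).

(** Complex differentiability with real radii and the real-valued modulus, in the
    form with a remainder, which makes sense at w = z as well. *)
Definition cdifferentiable (theta : C -> C) (z d : C) :=
  forall e : R, 0 < e -> exists2 dl : R, 0 < dl & forall w, normc (w - z) < dl ->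
    normc (theta w - theta z - d * (w - z)) <= e * normc (w - z).

Lemma derivable_cdifferentiable (theta : C -> C) z :
  derivable (theta : C^o -> C^o) z 1 -> exists d, cdifferentiable theta z d.
Proof.
move=> /cvg_ex[/= d /cvgrPdist_le cvg_d]; exists d => e e0.
have eC : (0 : C) < e%:C by rewrite ltcR.
have /nbhs_ballP[r /= r0 H] := cvg_d _ eC.
have rE : r = (Re r)%:C.
  by apply: complexP => //=; move: r0; rewrite ltcE /= => /andP[/eqP].
exists (Re r); first by move: r0; rewrite ltcE => /andP[].
move=> w wz; have [->|wNz] := eqVneq w z.
  by rewrite !subrr mulr0 subr0 normc0 mulr0.
have wz0 : w - z != 0 by rewrite subr_eq0.
have bw : ball (0 : C^o) r (w - z).
  have wz' : (normc (w - z))%:C < (Re r)%:C by rewrite ltcR.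
  by rewrite /ball /= sub0r normrN rE; exact: wz'.
have : (normc (d - (w - z)^-1 * (theta ((w - z) * 1 + z) - theta z)))%:C <= e%:C.
  exact: H (w - z) bw wz0.
rewrite mulr1 subrK lecR => le.
rewrite (_ : theta w - theta z - d * (w - z) =
  - (w - z) * (d - (w - z)^-1 * (theta w - theta z))); last by field.
by rewrite normcM normcN mulrC ler_wpM2r ?normc_ge0.
Qed.

Lemma cdifferentiable_cont (theta : C -> C) z d : cdifferentiable theta z d ->
  forall e : R, 0 < e -> exists2 dl : R, 0 < dl & forall w, normc (w - z) < dl ->
    normc (theta w - theta z) <= e.
Proof.
move=> dif e e0; have [dl dl0 H] := dif 1 ltr01.
have M0 : 0 < 1 + normc d by rewrite ltr_pwDl ?normc_ge0.
exists (Num.min dl (e / (1 + normc d))); first by rewrite lt_min dl0 divr_gt0.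
move=> w; rewrite lt_min ltr_pdivlMr// => /andP[/H h wz].
rewrite -(subrK (d * (w - z)) (_ - _)) (le_trans (le_normcD _ _))//.
rewrite (le_trans _ (ltW wz))// [leRHS]mulrDr mulr1 normcM lerD//.
  by rewrite mul1r in h.
by rewrite mulrC.
Qed.

Lemma ccont_comp (theta : C -> C) (g : R -> C) :
  (forall t, exists d, cdifferentiable theta (g t) d) -> ccont g ->
  ccont (fun t => theta (g t)).
Proof.
move=> dif /ccontP cg; apply/ccontP => t e e0.
have [d /cdifferentiable_cont/(_ e e0)[dl dl0 H]] := dif t.
have dl2 : 0 < dl / 2 by rewrite divr_gt0.
have [dt dt0 Ht] := cg t _ dl2.
exists dt => // s /Ht st; apply: H; rewrite (le_lt_trans st)//.
by rewrite ltr_pdivrMr// ltr_pMr// ltr1n.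
Qed.

Lemma ccontV (f : R -> C) : ccont f -> (forall t, f t != 0) ->
  ccont (fun t => (f t)^-1).
Proof.
move=> [cr ci] f0.
have n0 t : Re (f t) ^+ 2 + Im (f t) ^+ 2 != 0.
  rewrite -sqr_normcE sqrf_eq0; apply: contra (f0 t) => /eqP/eq0_normc ->//.
have cn : continuous (fun t => (Re (f t) ^+ 2 + Im (f t) ^+ 2)^-1).
  move=> t; apply: cvgV => //.
  exact: (cvgD (cvgM (cr t) (cr t)) (cvgM (ci t) (ci t))).
have inv z : z^-1 = (Re z / (Re z ^+ 2 + Im z ^+ 2)) +i*
    (- Im z / (Re z ^+ 2 + Im z ^+ 2)) :> C.
  by case: z => a b; apply: complexP; rewrite /= ?mulNr.
split=> t; under eq_fun do rewrite inv /=.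
- exact: cvgM (cr t) (cn t).
- exact: cvgM (cvgN (ci t)) (cn t).
Qed.

End Differentiability.

Section CirclePoint.
Context {R : realType}.
Local Notation C := (R[i]).

Lemma normc_circle_pt (t : R) : normc (circle_pt t) = 1.
Proof. by rewrite /= cos2Dsin2 sqrtr1. Qed.

Lemma circle_pt_neq0 (t : R) : circle_pt t != 0.
Proof.
apply/negP => /eqP/(congr1 (@normc R)); rewrite normc_circle_pt normc0.
by move/eqP; rewrite oner_eq0.
Qed.

Lemma circle_ptD (s t : R) : circle_pt (s + t) = circle_pt s * circle_pt t.
Proof.
by apply: complexP; rewrite !cReImE /= ?cosD ?sinD// addrC.
Qed.

Lemma circle_pt_conj (t : R) : (circle_pt t)^* = (circle_pt t)^-1.
Proof.
apply: (mulfI (circle_pt_neq0 t)).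
by rewrite mulc_conj normc_circle_pt expr1n divff// circle_pt_neq0.
Qed.

Lemma circle_pt0 : circle_pt 0 = 1 :> C.
Proof. by apply: complexP; rewrite /= ?cos0 ?sin0. Qed.

Lemma circle_pt2pi : circle_pt (2 * pi) = 1 :> C.
Proof. by apply: complexP; rewrite /= mulr_natl ?cos2pi ?sin2pi. Qed.

Lemma circle_ptN (t : R) : circle_pt (- t) = (circle_pt t)^-1.
Proof.
apply: (mulfI (circle_pt_neq0 t)).
by rewrite -circle_ptD subrr circle_pt0 divff// circle_pt_neq0.
Qed.

Lemma circle_ptX (t : R) (n : int) : circle_pt t ^ n = circle_pt (n%:~R * t).
Proof.
have nat_case m : circle_pt t ^+ m = circle_pt (m%:R * t).
  elim: m => [|m ih]; first by rewrite expr0 mul0r circle_pt0.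
  by rewrite exprSr ih -natr1 mulrDl mul1r circle_ptD.
case: n => m; first exact: nat_case.
by rewrite NegzE -exprnN nat_case mulrNz mulNr circle_ptN.
Qed.

Lemma normc_circle_ptX (t : R) (n : int) : normc (circle_pt t ^ n) = 1.
Proof. by rewrite circle_ptX normc_circle_pt. Qed.

Lemma circle_ptX_conj (t : R) (n : int) : (circle_pt t ^ n)^* = circle_pt t ^ (- n).
Proof. by rewrite circle_ptX circle_pt_conj -circle_ptN circle_ptX mulrNz mulNr. Qed.

Lemma cderiv_circle_pt (k t : R) :
  cderiv (fun s => circle_pt (k * s)) t ('i%C * k%:C * circle_pt (k * t)).
Proof.
have kd : is_derive t (1 : R) (fun s : R => k * s) k.
  by have := is_deriveZ k (is_derive_id t (1 : R)); rewrite /GRing.scale/= mulr1.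
split; rewrite !cReImE /=.
- apply: (is_derive_eq (is_derive1_comp (is_derive_cos (k * t)) kd)).
  by ring.
- apply: (is_derive_eq (is_derive1_comp (is_derive_sin (k * t)) kd)).
  by ring.
Qed.

Lemma ccont_circle_pt : ccont (@circle_pt R).
Proof. by split=> t /=; [exact: continuous_cos|exact: continuous_sin]. Qed.

Lemma ccont_circle_ptX (n : int) : ccont (fun t : R => circle_pt t ^ n).
Proof.
have cM : continuous (fun t : R => n%:~R * t) by exact: mulrl_continuous.
under eq_fun do rewrite circle_ptX.
by split=> t /=; apply: continuous_comp; [exact: cM|exact: continuous_cos|
  exact: cM|exact: continuous_sin].
Qed.

(** For n <> 0 the primitive z^n / (i n) is 2 pi-periodic. *)
Lemma cint_circle_ptX (n : int) :
  cint circle_measure (fun t : R => circle_pt t ^ n) = (n == 0)%:R.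
Proof.
have [->|n0] := eqVneq n 0.
  rewrite (circle_integral_primitive (F := fun t => t%:C) (M := 1)).
  - by rewrite -rmorphB subr0 -rmorphM mulVf// gt_eqF// two_pi_gt0.
  - exact: ccont_circle_ptX.
  - by move=> t; rewrite normc_circle_ptX.
  - by move=> t _; rewrite expr0z; exact: cderiv_real.
have k0 : 'i%C * (n%:~R)%:C != 0 :> C.
  by rewrite mulf_neq0// ?eq_complex /= ?oner_eq0 ?andbF ?intr_eq0 ?(negbTE n0).
rewrite (circle_integral_primitive
  (F := fun t => ('i%C * (n%:~R)%:C)^-1 * circle_pt (n%:~R * t)) (M := 1)).
- by rewrite -!circle_ptX circle_pt2pi circle_pt0 !exp1rz subrr mulr0.
- exact: ccont_circle_ptX.
- by move=> t; rewrite normc_circle_ptX.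
- move=> t _; rewrite circle_ptX -[X in cderiv _ _ X](mulKf k0).
  exact/cderivZ/cderiv_circle_pt.
Qed.

End CirclePoint.

(** * Cauchy's formula and the power series of theta *)
Section CauchyFormula.
Context {R : realType}.
Local Notation C := (R[i]).

Lemma realC_eq0 (x : R) : (x%:C == 0 :> C) = (x == 0).
Proof. by rewrite eq_complex /= eqxx andbT. Qed.

(** Lets the length of a partial sum tend to infinity in a tail estimate. *)
Lemma le_geometric_le0 (x B q : R) : 0 <= q < 1 ->
  (forall N, x <= B * q ^+ N) -> x <= 0.
Proof.
move=> /andP[q0 q1] H.
have q1' : `|q| < 1 by rewrite ger0_norm.
apply: (cvgr_to_ge (cvg_geometric B q1')).
by apply: nearW => N; exact: H.
Qed.

Context (theta : C -> C) (M : R).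
Hypothesis theta_diff : forall z, normc z < 1 -> exists d, cdifferentiable theta z d.
Hypothesis theta_bound : forall z, normc z < 1 -> normc (theta z) <= M.

Section FixedPoint.
Context (rho : R) (w : C).
Hypothesis rho_lt1 : rho < 1.
Hypothesis w_lt_rho : normc w < rho.

(* zeta runs over the circle of radius rho, Phi s contracts that circle towards w,
   and kappa dt is the form dz / (z - w), which the contraction preserves. *)
Let zeta (t : R) : C := rho%:C * circle_pt t.
Let v (t : R) : C := zeta t - w.
Let Phi (s t : R) : C := w + s%:C * v t.
Let kappa (t : R) : C := 'i%C * zeta t / v t.
Let m : R := rho - normc w.

Let rho_gt0 : 0 < rho. Proof. exact: le_lt_trans (normc_ge0 _) w_lt_rho. Qed.
Let m_gt0 : 0 < m. Proof. by rewrite subr_gt0. Qed.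

Let normc_zeta t : normc (zeta t) = rho.
Proof. by rewrite normcM normc_circle_pt normc_real mulr1 ger0_norm// ltW. Qed.

Let v_ge t : m <= normc (v t).
Proof. by rewrite /m -(normc_zeta t); exact: le_normcB. Qed.

Let v_neq0 t : v t != 0.
Proof. by apply: contraTneq (v_ge t) => ->; rewrite normc0 -ltNge. Qed.

Let v_le2 t : normc (v t) <= 2.
Proof.
rewrite (le_trans (le_normcD _ _))// normcN normc_zeta.
move: rho_lt1 w_lt_rho; lra.
Qed.

Let Phi_lt1 s t : 0 <= s <= 1 -> normc (Phi s t) < 1.
Proof.
move=> /andP[s0 s1]; have -> : Phi s t = (1 - s)%:C * w + s%:C * zeta t.
  by rewrite /Phi /v (rmorphB (real_complex R)) rmorph1; ring.
rewrite (le_lt_trans (le_normcD _ _))// (normcM _ w) (normcM _ (zeta t)).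
rewrite !normc_real normc_zeta !ger0_norm ?subr_ge0//; have := normc_ge0 w; move: rho_lt1 w_lt_rho.
move: (normc w) => x; nra.
Qed.

Let cont_zeta : ccont zeta.
Proof. apply: ccontM; [exact: ccont_cst|exact: ccont_circle_pt]. Qed.

Let cont_v : ccont v.
Proof. by apply: ccontD => //; exact: ccont_cst. Qed.

Let cont_kappa : ccont kappa.
Proof.
apply: ccontM; first by apply: ccontM => //; exact: ccont_cst.
exact: ccontV.
Qed.

Let kappa_le t : normc (kappa t) <= m^-1.
Proof.
rewrite (normcM _ (v t)^-1) (normcM _ (zeta t)) normcV normc_zeta.
rewrite (_ : normc 'i%C = 1); last first.
  by rewrite /= expr0n/= add0r expr1n sqrtr1.
rewrite mul1r -[leRHS]mul1r ler_pM ?(ltW rho_gt0) ?invr_ge0 ?normc_ge0 ?(ltW rho_lt1)//.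
by rewrite lef_pV2 ?posrE// (lt_le_trans m_gt0).
Qed.

Let zeta_deriv t : cderiv zeta t ('i%C * zeta t).
Proof.
have := cderivZ rho%:C (cderiv_circle_pt 1 t).
under eq_fun do rewrite mul1r.
by rewrite mulr1 mul1r mulrCA.
Qed.

Let zeta_kappa t : 'i%C * zeta t = v t * kappa t.
Proof. by rewrite /kappa [RHS]mulrCA divff// mulr1. Qed.

Let zeta_lip s t : normc (zeta s - zeta t) <= 2 * `|s - t|.
Proof.
wlog st : s t / t <= s.
  move=> h; have [/h//|/ltW/h] := leP t s.
  by rewrite normcB distrC.
rewrite ger0_norm ?subr_ge0// -[X in 2 * X]mul1r.
apply: (cderiv_increment_le st (fun x _ => zeta_deriv x)) => x _.
rewrite (normcM _ (zeta x)) normc_zeta (_ : normc 'i%C = 1) ?mul1r ?(ltW rho_lt1)//.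
by rewrite /= expr0n/= add0r expr1n sqrtr1.
Qed.

Let cont_theta_Phi s : 0 <= s <= 1 -> ccont (fun t => theta (Phi s t)).
Proof.
move=> s01; apply: ccont_comp => [t|]; first exact/theta_diff/Phi_lt1.
apply: ccontD; first exact: ccont_cst.
by apply: ccontM; [exact: ccont_cst|].
Qed.

Section Annulus.
Context (s0 : R).
Hypothesis s0_gt0 : 0 < s0.
Hypothesis s0_lt1 : s0 < 1.

(* Primitives in s are needed up to the end points of [s0, 1] but theta is only
   known inside the disk; clamping s extends the integrand continuously. *)
Let clamp (s : R) : R := Num.max s0 (Num.min 1 s).

Let clamp_itv s : s0 <= clamp s <= 1.
Proof. by rewrite /clamp ge_max le_max lexx/= ltW//= ge_min lexx. Qed.

Let clampE s : s0 <= s <= 1 -> clamp s = s.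
Proof. by move=> /andP[s0s s1]; rewrite /clamp (min_idPr s1) (max_idPr s0s). Qed.

Let cont_clamp : ccont (fun s => (clamp s)%:C).
Proof.
split=> s /=; last exact: cvg_cst.
apply: (@continuous_max R R (fun=> s0) (fun s => Num.min 1 s) s); first exact: cvg_cst.
by apply: (@continuous_min R R (fun=> 1) id s); [exact: cvg_cst|exact: cvg_id].
Qed.

Let clamp01 s : 0 <= clamp s <= 1.
Proof. by have /andP[h ->] := clamp_itv s; rewrite (le_trans (ltW s0_gt0)). Qed.

(* The constant function 1 is included for the affine part of theta. *)
Let ex_clamped_primitive (c : C -> C) t :
  (c = theta \/ c = fun=> 1) ->
  exists G : R -> C, forall s, s0 <= s <= 1 ->
    cderiv G s (c (Phi s t) * (s%:C)^-1).
Proof.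
move=> cE.
have cc : ccont (fun s => c (Phi (clamp s) t)).
  case: cE => ->; last exact: ccont_cst.
  apply: ccont_comp => [s|]; first exact/theta_diff/Phi_lt1.
  apply: ccontD; first exact: ccont_cst.
  by apply: ccontM => //; exact: ccont_cst.
have c0 s : (clamp s)%:C != 0 :> C.
  rewrite realC_eq0 gt_eqF// (lt_le_trans s0_gt0)//.
  by case/andP: (clamp_itv s).
have lt : s0 - 1 < 2 :> R by move: s0_lt1; lra.
have [G GP] := ex_primitive lt (ccontM cc (ccontV cont_clamp c0)).
exists G => s s01; have := GP s; rewrite (clampE s01); apply.
by move: s01 => /andP[? ?]; apply/andP; split; lra.
Qed.

(** The form theta(z) dz / (z - w) pulled back by Phi is theta(Phi) kappa dt +
    theta(Phi) ds / s. It is closed, and its integrals along t = 0 and t = 2 pi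
    cancel by periodicity, so that those along s = s0 and s = 1 agree. *)
Lemma circle_shrink :
  cint circle_measure (fun t => theta (Phi 1 t) * kappa t) =
  cint circle_measure (fun t => theta (Phi s0 t) * kappa t).
Proof.
have pi0 := two_pi_gt0 R.
have lt : -1 < 2 * pi + 1 :> R by move: pi0; lra.
have s01 s : s0 <= s <= 1 -> 0 <= s <= 1.
  by case/andP => h ->; rewrite (le_trans (ltW s0_gt0)).
have itv t : 0 <= t <= 2 * pi -> -1 < t < 2 * pi + 1.
  by case/andP => ? ?; apply/andP; split; lra.
have /choice[V VP] s : exists F : R -> C, s0 <= s <= 1 ->
    forall t, 0 <= t <= 2 * pi -> cderiv F t (theta (Phi s t) * kappa t).
  have [/s01 s1|nin] := boolP (s0 <= s <= 1); last by exists (fun=> 0).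
  have [F FP] := ex_primitive lt (ccontM (cont_theta_Phi s1) cont_kappa).
  by exists F => _ t /itv; exact: FP.
have /choice[H HP] t := ex_clamped_primitive t (or_introl erefl).
have [L LP] := ex_clamped_primitive 0 (or_intror erefl).
have [K KP] := ex_primitive lt cont_kappa.
pose W s t := V s t - H t s.
have /mixed_diff_eq0 : forall p q, s0 <= p <= 1 -> 0 <= q <= 2 * pi -> forall e, 0 < e ->
    exists2 dl, 0 < dl & forall s1 s2 t1 t2,
      s0 <= s1 -> s1 <= p <= s2 -> s2 <= 1 -> 0 <= t1 -> t1 <= q <= t2 -> t2 <= 2 * pi ->
      s2 - s1 < dl -> t2 - t1 < dl ->
      normc (mixed_diff W s1 s2 t1 t2) <= e * (s2 - s1 + (t2 - t1)) ^+ 2.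
  move=> p q p01 q02 e e0.
  have [d dif] := theta_diff (Phi_lt1 q (s01 _ p01)).
  set A := m^-1 + s0^-1.
  have A0 : 0 < A by rewrite addr_gt0// invr_gt0.
  pose e' := e / (8 * A).
  have e'0 : 0 < e' by rewrite divr_gt0// mulr_gt0.
  have [dl dl0 Hdl] := dif _ e'0.
  exists (dl / 4); first by rewrite divr_gt0.
  move=> s1 s2 t1 t2 s01' /andP[s1p ps2] s21 t10 /andP[t1q qt2] t2p ds dt.
  set L0 := s2 - s1 + (t2 - t1).
  have L0_ge0 : 0 <= L0 by rewrite /L0; lra.
  (* c0 + d (z - w) is the first-order Taylor polynomial of theta at the base
     point, written around w so that its contributions to V and H cancel in the
     mixed difference; only the remainder, of order e' L0, is left. *)
  pose c0 := theta (Phi p q) - d * (Phi p q - w).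
  have near s t : s1 <= s <= s2 -> t1 <= t <= t2 ->
      normc (theta (Phi s t) - c0 - d * (s%:C * v t)) <= e' * (2 * L0).
    move=> /andP[ss1 ss2] /andP[tt1 tt2].
    have dPhi : normc (Phi s t - Phi p q) <= 2 * L0.
      rewrite (_ : Phi s t - Phi p q = (s - p)%:C * v t + p%:C * (zeta t - zeta q)).
        rewrite (le_trans (le_normcD _ _))// !normcM !normc_real /L0 mulrDr lerD//.
          rewrite mulrC ler_pM ?normc_ge0//.
          by rewrite ler_norml; apply/andP; split; lra.
        rewrite -[leRHS]mul1r ler_pM ?normc_ge0//.
          by rewrite ger0_norm; case/andP: (s01 _ p01).
        rewrite (le_trans (zeta_lip _ _))// ler_pM2l//.
        by rewrite ler_norml; apply/andP; split; lra.
      by rewrite /Phi /v (rmorphB (real_complex R)); ring.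
    rewrite (_ : theta (Phi s t) - c0 - d * (s%:C * v t) =
      theta (Phi s t) - theta (Phi p q) - d * (Phi s t - Phi p q)); last first.
      by rewrite /c0 /Phi; ring.
    rewrite (le_trans (Hdl _ _))// ?ler_pM2l//.
    by rewrite (le_lt_trans dPhi)// /L0; lra.
  have t12 : t1 <= t2 by lra.
  have s12 : s1 <= s2 by lra.
  have incV s : s1 <= s <= s2 -> normc ((V s t2 - c0 * K t2 - d * s%:C * zeta t2) -
      (V s t1 - c0 * K t1 - d * s%:C * zeta t1)) <=
      2 * (e' * (2 * L0) * m^-1 * (t2 - t1)).
    move=> s12'; have s_in : s0 <= s <= 1 by move: s12' => /andP[? ?]; apply/andP; split; lra.
    apply: (@cderiv_increment_le _ (fun t => V s t - c0 * K t - d * s%:C * zeta t)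
      (fun t => theta (Phi s t) * kappa t - c0 * kappa t - d * s%:C * ('i%C * zeta t))) => //.
      move=> t tt; have t_in : 0 <= t <= 2 * pi.
        by move: tt => /andP[? ?]; apply/andP; split; lra.
      apply: cderivB; last exact: cderivZ.
      by apply: cderivB; [exact: VP|apply/cderivZ/KP/itv].
    move=> t tt; rewrite zeta_kappa.
    rewrite (_ : _ - _ - _ = (theta (Phi s t) - c0 - d * (s%:C * v t)) * kappa t); last by ring.
    by rewrite normcM ler_pM ?normc_ge0// near.
  have incH t : t1 <= t <= t2 -> normc ((H t s2 - c0 * L s2 - d * v t * s2%:C) -
      (H t s1 - c0 * L s1 - d * v t * s1%:C)) <=
      2 * (e' * (2 * L0) * s0^-1 * (s2 - s1)).
    move=> tt.
    apply: (@cderiv_increment_le _ (fun s => H t s - c0 * L s - d * v t * s%:C)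
      (fun s => theta (Phi s t) * (s%:C)^-1 - c0 * (1 * (s%:C)^-1) - d * v t * 1)) => //.
      move=> s ss; have s_in : s0 <= s <= 1.
        by move: ss => /andP[? ?]; apply/andP; split; lra.
      apply: cderivB; last exact/cderivZ/cderiv_real.
      by apply: cderivB; [exact: HP|apply/cderivZ/LP].
    move=> s ss.
    have s_gt0 : 0 < s.
      by move: ss => /andP[ss1 _]; rewrite (lt_le_trans s0_gt0)// (le_trans s01').
    have sC : s%:C != 0 :> C by rewrite realC_eq0 gt_eqF.
    rewrite (_ : _ - _ - _ = (theta (Phi s t) - c0 - d * (s%:C * v t)) * (s%:C)^-1);
      last by field.
    rewrite normcM normcV normc_real (ger0_norm (ltW s_gt0)) ler_pM ?normc_ge0 ?near//.
      by rewrite invr_ge0 ltW.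
    by rewrite lef_pV2 ?posrE//; move: ss => /andP[? ?]; lra.
  have vB : v t2 - v t1 = zeta t2 - zeta t1 by rewrite /v; ring.
  have -> : mixed_diff W s1 s2 t1 t2 =
      ((V s2 t2 - c0 * K t2 - d * s2%:C * zeta t2) -
       (V s2 t1 - c0 * K t1 - d * s2%:C * zeta t1)) +
      - ((V s1 t2 - c0 * K t2 - d * s1%:C * zeta t2) -
       (V s1 t1 - c0 * K t1 - d * s1%:C * zeta t1)) +
      - ((H t2 s2 - c0 * L s2 - d * v t2 * s2%:C) -
       (H t2 s1 - c0 * L s1 - d * v t2 * s1%:C)) +
      ((H t1 s2 - c0 * L s2 - d * v t1 * s2%:C) -
       (H t1 s1 - c0 * L s1 - d * v t1 * s1%:C)).
    by rewrite /mixed_diff /W /v; ring.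
  rewrite (@le_trans _ _ (2 * (e' * (2 * L0) * m^-1 * (t2 - t1)) +
    2 * (e' * (2 * L0) * m^-1 * (t2 - t1)) + 2 * (e' * (2 * L0) * s0^-1 * (s2 - s1)) +
    2 * (e' * (2 * L0) * s0^-1 * (s2 - s1))))//.
    rewrite (le_trans (le_normcD _ _))// lerD//; last by rewrite incH// lexx.
    rewrite (le_trans (le_normcD _ _))// lerD//; last by rewrite normcN incH// t12 lexx.
    rewrite (le_trans (le_normcD _ _))// lerD// ?normcN incV// ?s12 lexx//.
  have -> : e * L0 ^+ 2 = 8 * (e' * L0 * (A * L0)).
    by rewrite /e'; field; rewrite gt_eqF.
  rewrite (_ : _ + _ + _ + _ = 8 * (e' * L0 * (m^-1 * (t2 - t1) + s0^-1 * (s2 - s1)))); last by ring.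
  have e'L0 : 0 <= e' * L0 by exact: mulr_ge0 (ltW e'0) L0_ge0.
  rewrite ler_pM2l// ler_wpM2l//.
  have : 0 <= m^-1 * (s2 - s1) by rewrite mulr_ge0 ?invr_ge0 ?subr_ge0// ltW.
  have : 0 <= s0^-1 * (t2 - t1) by rewrite mulr_ge0 ?invr_ge0 ?subr_ge0// ltW.
  rewrite /A /L0; move: (m^-1) (s0^-1) => x y; lra.
move=> /(_ (ltW s0_lt1) (ltW pi0)).
have zeta2pi : zeta (2 * pi) = zeta 0 by rewrite /zeta circle_pt2pi circle_pt0.
have H2pi : H (2 * pi) 1 - H (2 * pi) s0 = H 0 1 - H 0 s0.
  apply/eqP; rewrite -subr_eq0; apply/eqP/eq0_normc/eqP.
  rewrite eq_le normc_ge0 andbT.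
  rewrite (_ : _ - _ = (H (2 * pi) 1 - H 0 1) - (H (2 * pi) s0 - H 0 s0)); last by ring.
  rewrite [leRHS](_ : 0 = 2 * (0 * (1 - s0))); last by rewrite mul0r mulr0.
  apply: (@cderiv_increment_le _ (fun s => H (2 * pi) s - H 0 s) (fun=> 0)).
  - exact: ltW.
  - move=> s ss; have := cderivB (HP (2 * pi) s ss) (HP 0 s ss).
    by rewrite /Phi /v zeta2pi subrr.
  - by move=> s _; rewrite normc0.
move=> Weq0.
have VV : V 1 (2 * pi) - V 1 0 = V s0 (2 * pi) - V s0 0.
  apply/eqP; rewrite -subr_eq0; apply/eqP.
  rewrite (_ : _ - _ = mixed_diff W s0 1 0 (2 * pi) +
    ((H (2 * pi) 1 - H (2 * pi) s0) - (H 0 1 - H 0 s0))); last first.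
    by rewrite /mixed_diff /W; ring.
  by rewrite Weq0 H2pi subrr addr0.
have int s : s0 <= s <= 1 ->
    cint circle_measure (fun t => theta (Phi s t) * kappa t) =
    (2 * pi)^-1%:C * (V s (2 * pi) - V s 0).
  move=> ss; apply: (circle_integral_primitive (M := M * m^-1)).
  - by apply: ccontM => //; exact/cont_theta_Phi/s01.
  - by move=> t; rewrite normcM ler_pM ?normc_ge0// theta_bound// Phi_lt1// s01.
  - exact: VP.
by rewrite !int ?lexx ?(ltW s0_lt1)// VV.
Qed.

End Annulus.
(** On the contracted circle Phi s0 the values of theta are close to theta w when
    s0 is small, uniformly in t. *)
Lemma cauchy_formula :
  cint circle_measure (fun t => theta (zeta t) * kappa t) =
  theta w * cint circle_measure kappa.
Proof.
have kb : forall t, normc (kappa t) <= m^-1 by exact: kappa_le.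
have k_int : cintegrable circle_measure kappa.
  exact: cintegrable_bounded (ccont_meas cont_kappa) kb.
have w1 : normc w < 1 by exact: lt_trans w_lt_rho rho_lt1.
have [d dif] := theta_diff w1.
apply/eqP; rewrite -subr_eq0; apply/eqP/eq0_normc/eqP.
rewrite eq_le normc_ge0 andbT; apply/ler_addgt0Pr => e e0; rewrite add0r.
have [|dl dl0 Hdl] := cdifferentiable_cont dif (e := e * m / 2).
  by rewrite divr_gt0// mulr_gt0.
pose s0 := Num.min (1 / 2) (dl / 4) : R.
have s0_gt0 : 0 < s0 by rewrite lt_min !divr_gt0.
have s0_lt1 : s0 < 1 by rewrite gt_min ltr_pdivrMr// mul1r ltr1n.
have s0_dl : s0 * 2 < dl.
  have : s0 <= dl / 4 by rewrite ge_min lexx orbT.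
  by move: dl0; lra.
have s01 : 0 <= s0 <= 1 by rewrite !ltW.
have -> : (fun t => theta (zeta t) * kappa t) = (fun t => theta (Phi 1 t) * kappa t).
  by apply/funext => t; rewrite /Phi /v mul1r addrC subrK.
rewrite (circle_shrink s0_gt0 s0_lt1) -cintZ// -cintB//; last 2 first.
- apply: cintegrable_bmul k_int; first exact/ccont_meas/cont_theta_Phi.
  by move=> t; apply: theta_bound; exact: Phi_lt1.
- exact: cintegrableZ.
have c_int : circle_measure.-integrable [set: measurableTypeR R] (EFin \o cst (e / 2)).
  exact: finite_measure_integrable_cst.
rewrite (le_trans (normc_cint_le _ c_int _))//=.
- apply: cintegrableB; last exact: cintegrableZ.
  apply: cintegrable_bmul k_int; first exact/ccont_meas/cont_theta_Phi.
  by move=> t; apply: theta_bound; exact: Phi_lt1.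
- move=> t /=; rewrite -mulrBl normcM.
  rewrite (_ : e / 2 = (e * m / 2) * m^-1); last by field; rewrite gt_eqF.
  rewrite ler_pM ?normc_ge0//; apply: Hdl.
  rewrite /Phi addrC addKr normcM normc_real ger0_norm ?(ltW s0_gt0)//.
  by rewrite (le_lt_trans _ s0_dl)// ler_pM2l.
by rewrite circle_integral_cst mulrCA divff// mulr1.
Qed.

Let kernel (t : R) : C := zeta t / v t.

Let kappaE t : kappa t = 'i%C * kernel t.
Proof. by rewrite /kappa /kernel mulrA. Qed.

Let zeta_neq0 t : zeta t != 0.
Proof. by rewrite mulf_neq0// ?circle_pt_neq0// realC_eq0 gt_eqF. Qed.

Let cont_kernel : ccont kernel.
Proof. by apply: ccontM => //; exact: ccontV. Qed.

Let kernel_le t : normc (kernel t) <= m^-1.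
Proof.
have := kappa_le t; rewrite kappaE (normcM _ (kernel t)) (_ : normc 'i%C = 1) ?mul1r//.
by rewrite /= expr0n/= add0r expr1n sqrtr1.
Qed.

Let kernel_int : cintegrable circle_measure kernel.
Proof. exact: cintegrable_bounded (ccont_meas cont_kernel) kernel_le. Qed.

Let kernel_geometric N t : kernel t =
  \sum_(0 <= k < N) w ^+ k * (zeta t) ^- k + (w / zeta t) ^+ N * kernel t.
Proof.
elim: N => [|N ih]; first by rewrite big_nil add0r expr0 mul1r.
rewrite big_nat_recr//= -addrA {1}ih; congr (_ + _).
rewrite -exprVn -exprMn exprSr -mulrA -[X in X + _]mulr1 -mulrDr; congr (_ * _).
by rewrite /kernel /v; field; rewrite zeta_neq0 v_neq0.
Qed.

Let q : R := normc w / rho.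

Let q_itv : 0 <= q < 1.
Proof. by rewrite divr_ge0 ?normc_ge0 ?(ltW rho_gt0)//= ltr_pdivrMr// mul1r. Qed.

(** The kernel zeta / (zeta - w) is the geometric series of w / zeta; q ^+ N is the
    size of the tail. Used for theta, and for the constant 1, where
    it evaluates the integral of the kernel. *)
Lemma cauchy_expansion (g : C -> C) (B : R) N :
  ccont (fun t => g (zeta t)) -> (forall t, normc (g (zeta t)) <= B) ->
  normc (cint circle_measure (fun t => g (zeta t) * kernel t) -
    \sum_(0 <= k < N) cint circle_measure (fun t => g (zeta t) * zeta t ^- k) * w ^+ k) <=
  2 * (B / m) * q ^+ N.
Proof.
move=> cg gB.
have g_int : cintegrable circle_measure (fun t => g (zeta t)).
  exact: cintegrable_bounded (ccont_meas cg) gB.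
have zV_cont k : ccont (fun t => zeta t ^- k).
  by under eq_fun do rewrite -exprVn; apply/ccontX/ccontV.
have zV_bd k t : normc (zeta t ^- k) <= rho ^- k.
  by rewrite normcV normcX normc_zeta.
have gz_int k : cintegrable circle_measure (fun t => g (zeta t) * zeta t ^- k).
  under eq_fun do rewrite mulrC.
  exact: cintegrable_bmul (ccont_meas (zV_cont k)) (zV_bd k) g_int.
pose F k t := w ^+ k * (g (zeta t) * zeta t ^- k).
have F_int k : cintegrable circle_measure (F k) by exact: cintegrableZ.
have [sum_int sumE] := cint_sum N F_int.
rewrite (eq_bigr (fun k => cint circle_measure (F k))); last first.
  by move=> k _; rewrite /F cintZ// mulrC.
have gk_int : cintegrable circle_measure (fun t => g (zeta t) * kernel t).
  exact: cintegrable_bmul (ccont_meas cg) gB kernel_int.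
rewrite -sumE -cintB//.
have c_int : circle_measure.-integrable [set: measurableTypeR R] (EFin \o cst (B / m * q ^+ N)).
  exact: finite_measure_integrable_cst.
rewrite (le_trans (normc_cint_le _ c_int _))//=.
- exact: cintegrableB.
- move=> t /=; rewrite (_ : _ - _ = g (zeta t) * ((w / zeta t) ^+ N * kernel t)).
    rewrite (normcM _ (_ * kernel t)) (normcM _ (kernel t)) normcX normcM normcV normc_zeta.
    rewrite -/q (mulrC (q ^+ N)) mulrA ler_wpM2r ?exprn_ge0//; first by case/andP: q_itv.
    by rewrite ler_pM ?normc_ge0.
  rewrite (kernel_geometric N t) mulrDr addrAC mulr_sumr -sumrB big1 ?add0r//.
    by rewrite -kernel_geometric.
  by move=> k _; rewrite /F; ring.
by rewrite circle_integral_cst !mulrA.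
Qed.

Let kernel_mean : cint circle_measure kernel = 1.
Proof.
apply/eqP; rewrite -subr_eq0; apply/eqP/eq0_normc/eqP.
rewrite eq_le normc_ge0 andbT.
apply: (@le_geometric_le0 _ (2 * (1 / m) * q) _ q_itv) => n.
have := @cauchy_expansion (fun=> 1) 1 n.+1 (ccont_cst 1).
rewrite normc1 => /(_ (fun=> lexx 1)).
rewrite exprS mulrA; apply: le_trans; rewrite le_eqVlt; apply/orP; left; apply/eqP.
congr normc; congr (_ - _); first by congr cint; apply/funext => t; rewrite mul1r.
rewrite big_nat_recl//= big1_seq ?addr0.
  rewrite expr0 mulr1 [X in cint _ X](_ : _ = fun t => circle_pt t ^ 0).
    by rewrite cint_circle_ptX.
  by apply/funext => t; rewrite expr0 invr1 mulr1 expr0z.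
move=> k _.
rewrite [X in cint _ X](_ : _ = fun t => (rho%:C ^- k.+1) * circle_pt t ^ (- k.+1%:Z)).
  rewrite cintZ ?cint_circle_ptX ?mulr0 ?mul0r//.
  apply: (@cintegrable_bounded _ _ _ _ _ 1); first exact/ccont_meas/ccont_circle_ptX.
  by move=> t; rewrite normc_circle_ptX.
by apply/funext => t; rewrite mul1r /zeta exprMn invfM -exprnN.
Qed.

Lemma power_series_remainder N :
  normc (theta w -
    \sum_(0 <= k < N) cint circle_measure (fun t => theta (zeta t) * zeta t ^- k) * w ^+ k) <=
  2 * (M / m) * q ^+ N.
Proof.
have theta_cont : ccont (fun t => theta (zeta t)).
  by apply: ccont_comp => // t; apply: theta_diff; rewrite normc_zeta.
have theta_bd t : normc (theta (zeta t)) <= M by apply: theta_bound; rewrite normc_zeta.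
suff <- : cint circle_measure (fun t => theta (zeta t) * kernel t) = theta w.
  exact: cauchy_expansion.
have i0 : 'i%C != 0 :> C by rewrite eq_complex /= oner_eq0 andbF.
have kE : kappa = (fun t => 'i%C * kernel t) by apply/funext => t; rewrite kappaE.
have := cauchy_formula; rewrite kE cintZ// kernel_mean mulr1 => E; apply: (mulfI i0).
rewrite -cintZ; last exact: cintegrable_bmul (ccont_meas theta_cont) theta_bd kernel_int.
by rewrite mulrC -E; congr cint; apply/funext => t; rewrite mulrCA.
Qed.

End FixedPoint.

Lemma power_series_approx (rho : R) : 0 < rho < 1 ->
  exists a : nat -> C, a 0%N = theta 0 /\
    forall w N, normc w < rho ->
      normc (theta w - \sum_(0 <= k < N) a k * w ^+ k) <=
      2 * (M / (rho - normc w)) * (normc w / rho) ^+ N.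
Proof.
move=> /andP[rho0 rho1].
pose zeta (t : R) : C := rho%:C * circle_pt t.
pose a k := cint circle_measure (fun t => theta (zeta t) * zeta t ^- k).
have approx w N (w_rho : normc w < rho) := power_series_remainder rho1 w_rho N.
exists a; split => [|w N w_rho]; last exact: approx.
(* At w = 0 the partial sum of length 1 is a 0 and the bound vanishes. *)
apply/esym/eqP; rewrite -subr_eq0; apply/eqP/eq0_normc/eqP.
rewrite eq_le normc_ge0 andbT.
have n0 : normc (0 : C) < rho by rewrite normc0.
by have := approx 0 1%N n0; rewrite big_nat1 expr0 mulr1 normc0 mul0r expr1 mulr0.
Qed.

End CauchyFormula.

(** * Radial boundary values *)
Section Boundary.
Context {R : realType}.
Local Notation C := (R[i]).
Local Notation mu := (@circle_measure R).
Context (theta : C -> C) (M : R).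
Hypothesis theta_diff : forall z, normc z < 1 -> exists d, cdifferentiable theta z d.
Hypothesis theta_bound : forall z, normc z < 1 -> normc (theta z) <= M.

(** Neighbourhoods in the complex plane have radii that are positive elements of
    the ordered field of complex numbers, and these are the positive reals. *)
Lemma radial_cvgP (t : R) (l : C) :
  (radial theta t r @[r --> (1 : R)^'-] --> (l : C^o)) <->
  forall e : R, 0 < e -> exists2 d : R, 0 < d & forall r, 1 - d < r < 1 ->
    normc (theta (r%:C * circle_pt t) - l) <= e.
Proof.
split=> [/cvgrPdist_le cl e e0|H].
  have eC : (0 : C) < e%:C by rewrite ltcR.
  have [d /= d0 Hd] := cl _ eC; exists d => // r /andP[dr r1].
  have : `|(l : C^o) - radial theta t r| <= e%:C.
    by apply: Hd => //=; rewrite ger0_norm ?subr_ge0 ?ltW//; lra.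
  by rewrite normcB -lecR.
apply/cvgrPdist_le => e e0.
have eE : e = (Re e)%:C.
  by apply: complexP => //=; move: e0; rewrite ltcE /= => /andP[/eqP].
have [|d d0 Hd] := H (Re e); first by move: e0; rewrite ltcE => /andP[].
exists d => //= r /= dr r1; rewrite eE.
have : normc (theta (r%:C * circle_pt t) - l) <= Re e.
  by apply: Hd; move: dr; rewrite r1 andbT ltr_norml; lra.
by rewrite normcB -lecR.
Qed.

Let rpt (r t : R) : C := r%:C * circle_pt t.

Let normc_rpt r t : normc (rpt r t) = `|r|.
Proof. by rewrite normcM normc_circle_pt normc_real mulr1. Qed.

Lemma ccont_dilate (r : R) : `|r| < 1 -> ccont (fun t => theta (rpt r t)).
Proof.
move=> r1; apply: ccont_comp => [t|].
  by apply: theta_diff; rewrite normc_rpt.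
by apply: ccontM; [exact: ccont_cst|exact: ccont_circle_pt].
Qed.

Lemma boundaryE t l : (radial theta t r @[r --> (1 : R)^'-] --> (l : C^o)) ->
  boundary theta t = l.
Proof. by move=> /cvg_lim; apply. Qed.

(** At angles without radial limit the limit operator returns a default value; it
    is a constant, hence does not spoil measurability or boundedness. *)
Lemma boundary_default t : ~ cvg (radial theta t r @[r --> (1 : R)^'-]) ->
  boundary theta t = (point : C^o).
Proof.
move=> ncvg; rewrite /boundary /lim /lim_in; apply: xgetPN => l cl.
by apply: ncvg; apply/cvg_ex; exists l.
Qed.

Definition radius (n : nat) : R := 1 - n.+2%:R^-1.

Lemma radius_itv n : 0 < radius n < 1.
Proof.
rewrite /radius subr_gt0 invf_lt1 ?ltr0n// ltr1n/= gtrDl oppr_lt0 invr_gt0 ltr0n//.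
Qed.

Lemma radius_near (d : R) : 0 < d -> exists N, forall n, (N <= n)%N -> 1 - d < radius n.
Proof.
move=> d0; exists (Num.bound d^-1) => n Nn.
rewrite /radius ltrD2l ltrN2 invf_plt ?posrE// (lt_le_trans (archi_boundP _))//.
  by rewrite invr_ge0 ltW.
by rewrite ler_nat (leq_trans Nn)// -addn2 leq_addr.
Qed.

Lemma boundary_cvg_radius t : cvg (radial theta t r @[r --> (1 : R)^'-]) ->
  forall e : R, 0 < e -> exists N, forall n, (N <= n)%N ->
    normc (theta (rpt (radius n) t) - boundary theta t) <= e.
Proof.
move=> /cvg_ex[l cl] e e0; rewrite (boundaryE cl).
have /radial_cvgP/(_ e e0)[d d0 Hd] := cl.
have [N NP] := radius_near d0; exists N => n /NP dn.
by apply: Hd; rewrite dn; case/andP: (radius_itv n).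
Qed.

Let B : R := Num.max M (normc (point : C^o)).

Lemma boundary_bound t : normc (boundary theta t) <= B.
Proof.
have [ct|/boundary_default ->] := pselect (cvg (radial theta t r @[r --> (1 : R)^'-])).
  rewrite le_max; apply/orP; left; apply/ler_addgt0Pr => e e0.
  have [N /(_ N (leqnn N)) H] := boundary_cvg_radius ct e0.
  have /andP[r0 r1] := radius_itv N.
  rewrite -(subrK (theta (rpt (radius N) t)) (boundary theta t)).
  rewrite (le_trans (le_normcD _ _))// addrC lerD// 1?normcB//.
  by apply: theta_bound; rewrite normc_rpt ger0_norm ?ltW.
by rewrite le_max lexx orbT.
Qed.

(* Radii are tested only at rational points, so that the Cauchy criterion below
   is a countable combination of Borel conditions on t. *)
Let ratpt (i : nat) : R := ratr (odflt 0 (unpickle i : option rat)).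

Let ratpt_dense (a b : R) : a < b -> exists i, a < ratpt i < b.
Proof.
move=> /rat_in_itvoo[p]; rewrite in_itv/= => pab.
by exists (pickle p); rewrite /ratpt pickleK.
Qed.

Let close (k m i j : nat) (t : R) : Prop :=
  1 - m.+1%:R^-1 < ratpt i < 1 -> 1 - m.+1%:R^-1 < ratpt j < 1 ->
  normc (theta (rpt (ratpt i) t) - theta (rpt (ratpt j) t)) ^+ 2 <= (k.+1%:R^-1) ^+ 2.

Let in_unit (m : nat) (r : R) : 1 - m.+1%:R^-1 < r < 1 -> `|r| < 1.
Proof.
move=> /andP[mr r1]; rewrite ger0_norm// ltW// (le_lt_trans _ mr)//.
by rewrite subr_ge0 invf_le1 ?ltr0n// ler1n.
Qed.

Let inv_small (e : R) : 0 < e -> exists k : nat, k.+1%:R^-1 < e.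
Proof.
move=> e0; exists (Num.bound e^-1).
have h : 0 <= e^-1 by rewrite invr_ge0 ltW.
by rewrite invf_plt ?posrE// (lt_le_trans (archi_boundP h))// ler_nat.
Qed.

(* Completeness is used componentwise, along a sequence of rational radii; the
   other radii are reached by continuity of theta in the open disk. *)
Let cauchy_radial t : cvg (radial theta t r @[r --> (1 : R)^'-]) <->
  forall k, exists m, forall i j, close k m i j t.
Proof.
have k_gt0 (k : nat) : 0 < k.+1%:R^-1 :> R by rewrite invr_gt0 ltr0n.
have closeE k m i j : close k m i j t <->
    (1 - m.+1%:R^-1 < ratpt i < 1 -> 1 - m.+1%:R^-1 < ratpt j < 1 ->
    normc (theta (rpt (ratpt i) t) - theta (rpt (ratpt j) t)) <= k.+1%:R^-1).
  by split=> H Hi Hj; have := H Hi Hj;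
    rewrite ler_pXn2r ?nnegrE ?normc_ge0 ?invr_ge0.
split=> [/cvg_ex[l /radial_cvgP cl] k|Hc].
  have k2 : 0 < k.+1%:R^-1 / 2 :> R by rewrite divr_gt0.
  have [d d0 Hd] := cl _ k2.
  have [N /(_ _ (leqnSn N)) NP] := radius_near d0.
  exists N.+2 => i j; apply/closeE => /andP[i1 i2] /andP[j1 j2].
  rewrite (_ : _ - _ = (theta (rpt (ratpt i) t) - l) - (theta (rpt (ratpt j) t) - l)); last by ring.
  rewrite (le_trans (le_normcD _ _))// normcN (splitr k.+1%:R^-1).
  by apply: lerD; apply: Hd; apply/andP; split => //; exact: lt_trans NP _.
have /choice[x xP] : forall n : nat, exists i, 1 - n.+1%:R^-1 < ratpt i < 1.
  by move=> n; apply: ratpt_dense; rewrite gtrDl oppr_lt0.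
have x_in m n : (m <= n)%N -> 1 - m.+1%:R^-1 < ratpt (x n) < 1.
  move=> mn; have /andP[h ->] := xP n; rewrite andbT (le_lt_trans _ h)//.
  by rewrite lerD2l lerN2 lef_pV2 ?posrE ?ltr0n// ler_nat.
pose f n := theta (rpt (ratpt (x n)) t).
have fC k : exists m, forall n n', (m <= n)%N -> (m <= n')%N -> normc (f n - f n') <= k.+1%:R^-1.
  have [m mP] := Hc k; exists m => n n' mn mn'.
  by have /closeE := mP (x n) (x n'); apply; exact: x_in.
have part (p : C -> R) : (forall z w, p (z - w) = p z - p w) ->
    (forall z, `|p z| <= normc z) -> exists l, (fun n => p (f n)) @ \oo --> (l : R).
  move=> pB pn; apply/cvg_ex/cauchy_cvgP/cauchy_exP => e e0.
  have [k ke] := inv_small e0.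
  have [m mP] := fC k; exists (p (f m)); exists m => // n /= mn.
  rewrite /ball /= -pB (le_lt_trans (pn _))// (le_lt_trans _ ke)//.
  exact: mP.
have [lr cvg_lr] := part (@complex.Re R) (fun z w => etrans (cReD _ _) (congr1 _ (cReN _)))
  (@normc_Re R).
have [li cvg_li] := part (@complex.Im R) (fun z w => etrans (cImD _ _) (congr1 _ (cImN _)))
  (@normc_Im R).
pose l := lr +i* li.
have cvg_f e : 0 < e -> exists N, forall n, (N <= n)%N -> normc (f n - l) <= e.
  move=> e0; have e2 : 0 < e / 2 by rewrite divr_gt0.
  have /cvgrPdist_le/(_ _ e2)[N1 _ H1] := cvg_lr.
  have /cvgrPdist_le/(_ _ e2)[N2 _ H2] := cvg_li.
  exists (maxn N1 N2) => n; rewrite geq_max => /andP[/H1 /= h1 /H2 /= h2].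
  by rewrite normcB (le_trans (normc_le _))// !cReImE /= (splitr e) lerD.
apply/cvg_ex; exists l; apply/radial_cvgP => e e0.
have [k ke] := inv_small (divr_gt0 e0 (ltr0n R 3)).
have [m mP] := Hc k; exists m.+1%:R^-1 => // r mr.
have /(theta_diff)[d /cdifferentiable_cont dif] : normc (rpt r t) < 1.
  by rewrite normc_rpt; exact: in_unit mr.
have [dl dl0 Hdl] := dif _ (k_gt0 k).
have [N NP] := cvg_f _ (k_gt0 k).
have [|i] := @ratpt_dense (Num.max (1 - m.+1%:R^-1) (r - dl)) r.
  by rewrite gt_max; case/andP: mr => -> _; rewrite /= gtrDl oppr_lt0.
rewrite gt_max => /andP[/andP[mi ri] ir].
have i_in : 1 - m.+1%:R^-1 < ratpt i < 1.
  by rewrite mi (lt_trans ir)//; case/andP: mr.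
have hi : normc (theta (rpt (ratpt i) t) - theta (rpt r t)) <= k.+1%:R^-1.
  apply: Hdl; rewrite /rpt -mulrBl -rmorphB normcM normc_circle_pt mulr1 normc_real.
  by rewrite ltr_norml; apply/andP; split; lra.
have hn := NP (maxn m N) (leq_maxr _ _).
have hin : normc (theta (rpt (ratpt i) t) - f (maxn m N)) <= k.+1%:R^-1.
  have /closeE := mP i (x (maxn m N)); apply => //.
  exact/x_in/leq_maxl.
rewrite (_ : _ - l = - (theta (rpt (ratpt i) t) - theta (rpt r t)) +
   ((theta (rpt (ratpt i) t) - f (maxn m N)) + (f (maxn m N) - l))); last by rewrite /rpt; ring.
rewrite (le_trans (le_normcD _ _))// normcN.
rewrite (le_trans (lerD hi (le_trans (le_normcD _ _) (lerD hin hn))))//.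
by move: ke; move: (k.+1%:R^-1) => y; rewrite ltr_pdivlMr// mulr_natr; lra.
Qed.

Let measurable_cvg_radial :
  measurable ([set t | cvg (radial theta t r @[r --> (1 : R)^'-])] : set (measurableTypeR R)).
Proof.
rewrite (_ : [set t | _] = \bigcap_k \bigcup_m \bigcap_i \bigcap_j [set t | close k m i j t]).
  apply: bigcapT_measurable => k; apply: bigcupT_measurable => m.
  apply: bigcapT_measurable => i; apply: bigcapT_measurable => j.
  have [ii|nii] := boolP (1 - m.+1%:R^-1 < ratpt i < 1); last first.
    rewrite [X in measurable X](_ : _ = setT)//.
    by apply/seteqP; split => // t _ ii; rewrite ii in nii.
  have [jj|njj] := boolP (1 - m.+1%:R^-1 < ratpt j < 1); last first.
    rewrite [X in measurable X](_ : _ = setT)//.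
    by apply/seteqP; split => // t _ _ jj; rewrite jj in njj.
  pose g t := theta (rpt (ratpt i) t) - theta (rpt (ratpt j) t).
  have gm : @cmeas _ (measurableTypeR R) _ g.
    by apply: cmeasD; [|apply: cmeasN]; apply: ccont_meas; apply: ccont_dilate;
      [exact: in_unit ii|exact: in_unit jj].
  have := measurable_normc2 gm => /(_ measurableT `]-oo, (k.+1%:R^-1) ^+ 2]%classic).
  move=> /(_ (measurable_itv _)); rewrite setTI.
  congr measurable; apply/seteqP; split => t /=; rewrite in_itv/=.
    by move=> h _ _.
  by move/(_ ii jj).
apply/seteqP; split => t /=.
  move=> /cauchy_radial h k _; have [m mP] := h k.
  by exists m => // i _ j _; exact: mP.
move=> h; apply/cauchy_radial => k; have [m _ mP] := h k Logic.I.
by exists m => i j; exact: mP.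
Qed.

(** On the Borel set of angles with a radial limit the boundary function is a
    pointwise limit of continuous functions, and off it a constant. *)
Lemma boundary_meas : @cmeas _ (measurableTypeR R) _ (boundary theta).
Proof.
pose D : set (measurableTypeR R) := [set t | cvg (radial theta t r @[r --> (1 : R)^'-])].
have mD : measurable D := measurable_cvg_radial.
have part (p : C -> R) : (forall z w, p (z - w) = p z - p w) ->
    (forall z, `|p z| <= normc z) ->
    (forall n, measurable_fun [set: measurableTypeR R] (fun t => p (theta (rpt (radius n) t)))) ->
    measurable_fun [set: measurableTypeR R] (fun t => p (boundary theta t)).
  move=> pB pn pm; rewrite -(setUv D); apply/measurable_funU => //.
    exact: measurableC.
  split.
    apply: (@measurable_fun_cvg _ _ _ _ (fun n t => p (theta (rpt (radius n) t)))).
      by move=> n; exact: measurable_funTS (pm n).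
    move=> t Dt; apply/cvgrPdist_le => e e0.
    have [N NP] := boundary_cvg_radius Dt e0.
    exists N => // n /NP h; rewrite distrC -pB; exact: le_trans (pn _) h.
  apply: (eq_measurable_fun (fun=> p (point : C^o))) => // t.
  by rewrite inE => /boundary_default ->.
have meas n : @cmeas _ (measurableTypeR R) _ (fun t => theta (rpt (radius n) t)).
  apply: ccont_meas; apply: ccont_dilate.
  by have /andP[? ?] := radius_itv n; rewrite ger0_norm// ltW.
split.
- apply: (part (@complex.Re R)) => [z w|z|n]; [by rewrite !cReImE|exact: normc_Re|].
  by case: (meas n).
- apply: (part (@complex.Im R)) => [z w|z|n]; [by rewrite !cReImE|exact: normc_Im|].
  by case: (meas n).
Qed.

Lemma boundary_int_limit (g : R -> C) (c : C) :
  {ae mu, forall t, cvg (radial theta t r @[r --> (1 : R)^'-])} ->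
  cintegrable mu g ->
  (forall n, cint mu (fun t => theta (rpt (radius n) t) * g t) = c) ->
  cint mu (fun t => boundary theta t * g t) = c.
Proof.
move=> cv gi Hc.
have r1 n : `|radius n| < 1.
  by have /andP[? ?] := radius_itv n; rewrite ger0_norm// ltW.
have meas n : @cmeas _ (measurableTypeR R) _ (fun t => theta (rpt (radius n) t)).
  exact/ccont_meas/ccont_dilate.
have bd n t : normc (theta (rpt (radius n) t)) <= M.
  by apply: theta_bound; rewrite normc_rpt.
have gm := cintegrable_meas gi.
have dom_int := cintegrable_normc gi.
have M0 : 0 <= M by exact: le_trans (normc_ge0 _) (bd 0%N 0).
have part (p : C -> R) : (forall z w, p (z - w) = p z - p w) ->
    (forall z, `|p z| <= normc z) ->
    (forall f : R -> C, @cmeas _ (measurableTypeR R) _ f ->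
       measurable_fun [set: measurableTypeR R] (fun t => p (f t))) ->
    (forall n, \int[mu]_t p (theta (rpt (radius n) t) * g t) = p c) ->
    \int[mu]_t p (boundary theta t * g t) = p c.
  move=> pB pn pm pc.
  have lim_ae : {ae mu, forall t, [set: measurableTypeR R] t ->
     (fun n => (p (theta (rpt (radius n) t) * g t))%:E) @ \oo -->
       (p (boundary theta t * g t))%:E}.
    apply: ae_imply cv => t ct _; apply: cvg_EFin; first exact: nearW.
    apply/cvgrPdist_le => e e0.
    have G0 : 0 < normc (g t) + 1 by rewrite ltr_wpDl ?normc_ge0.
    have [N NP] := boundary_cvg_radius ct (divr_gt0 e0 G0).
    exists N => // n /NP h; rewrite /= distrC -pB (le_trans (pn _))// -mulrBl normcM.
    rewrite (@le_trans _ _ (e / (normc (g t) + 1) * (normc (g t) + 1)))//.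
      by rewrite ler_pM ?normc_ge0// lerDl.
    by rewrite divfK// gt_eqF.
  have f_int n : mu.-integrable [set: measurableTypeR R]
      (EFin \o (fun t => p (theta (rpt (radius n) t) * g t))).
    apply: le_integrable (integrableZl measurableT M dom_int) => //.
      by apply/measurable_EFinP; apply: pm; exact: cmeasM.
    move=> t _ /=; rewrite lee_fin (le_trans (pn _))// normcM.
    rewrite (le_trans _ (ler_norm _))// ler_pM ?normc_ge0//; exact: normc_le.
  have dom : {ae mu, forall t n, [set: measurableTypeR R] t ->
      (`|(p (theta (rpt (radius n) t) * g t))%:E| <=
       M%:E * (`|complex.Re (g t)| + `|complex.Im (g t)|)%:E)%E}.
    apply: aeW => t n _ /=; rewrite -EFinM lee_fin (le_trans (pn _))// normcM.
    by rewrite ler_pM ?normc_ge0//; exact: normc_le.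
  have [i_lim _ lim] := @dominated_convergence _ _ _ mu [set: measurableTypeR R] measurableT
    (fun n t => (p (theta (rpt (radius n) t) * g t))%:E)
    (fun t => (p (boundary theta t * g t))%:E)
    (fun t => (M%:E * (`|complex.Re (g t)| + `|complex.Im (g t)|)%:E)%E)
    (fun n => measurable_int _ (f_int n))
    (proj2 (measurable_EFinP _ _) (pm _ (cmeasM boundary_meas gm)))
    lim_ae (integrableZl measurableT M dom_int) dom.
  rewrite /Rintegral.
  suff -> : (\int[mu]_t (p (boundary theta t * g t))%:E = (p c)%:E)%E by [].
  apply: (cvg_unique _ lim) => //.
  rewrite (_ : [sequence _]_n = fun=> (p c)%:E); first exact: cvg_cst.
  apply/funext => n /=; rewrite -(pc n) /Rintegral fineK//.
  exact: integrable_fin_num (f_int n).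
apply: complexP => /=.
- apply: (part (@complex.Re R)) => [z w|z|f [//]|n]; [by rewrite !cReImE|exact: normc_Re|].
  by rewrite -(Hc n).
- apply: (part (@complex.Im R)) => [z w|z|f [//]|n]; [by rewrite !cReImE|exact: normc_Im|].
  by rewrite -(Hc n).
Qed.

(** The mean value property (theta g)(0) = theta(0) g(0). On the circle of radius r
    the function theta is a uniform limit of its Taylor polynomials, and all their
    terms but the constant one integrate to 0 against g. *)
Lemma boundary_mean_value (g : R -> C) :
  {ae mu, forall t, cvg (radial theta t r @[r --> (1 : R)^'-])} ->
  cintegrable mu g ->
  (forall k : nat, cint mu (fun t => circle_pt t ^ k.+1 * g t) = 0) ->
  cint mu (fun t => boundary theta t * g t) = theta 0 * cint mu g.
Proof.
move=> cv gi g0; apply: boundary_int_limit => // n.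
have /andP[r0 r1] := radius_itv n; set r := radius n in r0 r1 *.
(* Any radius strictly between r and 1 would do. *)
pose rho := (1 + r) / 2.
have rho01 : 0 < rho < 1 by rewrite /rho; apply/andP; split; lra.
have r_rho : r < rho by rewrite /rho; lra.
have rho0 : 0 < rho by case/andP: rho01.
have [a [a0 aP]] := power_series_approx theta_diff theta_bound rho01.
have r_abs : `|r| = r by rewrite ger0_norm// ltW.
have th_int : cintegrable mu (fun t => theta (rpt r t) * g t).
  apply: (cintegrable_bmul (M := M)) gi; first by apply/ccont_meas/ccont_dilate; rewrite r_abs.
  by move=> t; apply: theta_bound; rewrite normc_rpt r_abs.
pose S N := 2 * (M / (rho - r)) * (r / rho) ^+ N.
have dom_int := cintegrable_normc gi.
set G := \int[mu]_t (`|complex.Re (g t)| + `|complex.Im (g t)|).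
apply/eqP; rewrite -subr_eq0; apply/eqP/eq0_normc/eqP.
rewrite eq_le normc_ge0 andbT.
have q_itv : 0 <= r / rho < 1.
  by rewrite divr_ge0 ?ltW//= ltr_pdivrMr// mul1r.
apply: (@le_geometric_le0 _ _ (2 * (2 * (M / (rho - r)) * (r / rho) * G)) _ q_itv) => N.
pose F k t := (a k * r%:C ^+ k) * (circle_pt t ^ k * g t).
have F_int k : cintegrable mu (F k).
  apply: cintegrableZ; apply: (cintegrable_bmul (M := 1)) gi.
    exact/ccont_meas/ccont_circle_ptX.
  by move=> t; rewrite normc_circle_ptX.
have [sum_int sumE] := cint_sum N.+1 F_int.
have -> : theta 0 * cint mu g = cint mu (fun t => \sum_(0 <= k < N.+1) F k t).
  rewrite sumE big_nat_recl//= big1_seq ?addr0.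
    rewrite /F expr0 mulr1 a0 cintZ.
      by congr (_ * cint _ _); apply/funext => t; rewrite expr0z mul1r.
    by under eq_fun do rewrite expr0z mul1r.
  move=> k _; rewrite /F cintZ ?g0 ?mulr0//.
  apply: (cintegrable_bmul (M := 1)) gi; first exact/ccont_meas/ccont_circle_ptX.
  by move=> t; rewrite normc_circle_ptX.
rewrite -cintB//.
have S_int := integrableZl measurableT (S N.+1) dom_int.
have S_dom t : normc (theta (rpt r t) * g t - \sum_(0 <= k < N.+1) F k t) <=
    S N.+1 * (`|complex.Re (g t)| + `|complex.Im (g t)|).
  rewrite (_ : _ - _ = (theta (rpt r t) - \sum_(0 <= k < N.+1) a k * rpt r t ^+ k) * g t).
    have := aP (rpt r t) N.+1; rewrite normc_rpt r_abs => /(_ r_rho) h.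
    by rewrite normcM ler_pM ?normc_ge0// normc_le.
  rewrite mulrBl mulr_suml; congr (_ - _); apply: eq_bigr => k _.
  by rewrite /F /rpt exprMn -exprnP; ring.
have := normc_cint_le (cintegrableB th_int sum_int) S_int S_dom.
move=> /le_trans; apply.
rewrite RintegralZl// -/G /S exprS le_eqVlt; apply/orP; left; apply/eqP; ring.
Qed.

End Boundary.

(** * Fourier coefficients and shifts on the Hardy space *)
Section HardySpaceTheory.
Context {R : realType}.
Local Notation C := (R[i]).
Local Notation mu := (@circle_measure R).
Local Notation z := (@circle_pt R).
Implicit Types f g h : R -> C.

Lemma cmeas_circle_ptX (n : int) : @cmeas _ (measurableTypeR R) _ (fun t : R => z t ^ n).
Proof. exact/ccont_meas/ccont_circle_ptX. Qed.

Lemma inL2_shift f : inL2 f -> inL2 (fun t => z t * f t).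
Proof.
apply: (@inL2_bmul _ z f 1); first exact/ccont_meas/ccont_circle_pt.
by move=> t; rewrite normc_circle_pt.
Qed.

Lemma inL2_circle_ptX (n : int) : inL2 (fun t : R => z t ^ n).
Proof.
apply: (@inL2_bounded _ _ 1); first exact: cmeas_circle_ptX.
by move=> t; rewrite normc_circle_ptX.
Qed.

Lemma inL2_unshift f : inL2 f -> inL2 (fun t => (z t)^-1 * f t).
Proof.
apply: (@inL2_bmul _ (fun t => (z t)^-1) f 1).
  by apply/ccont_meas/ccontV; [exact: ccont_circle_pt|exact: circle_pt_neq0].
by move=> t; rewrite normcV normc_circle_pt invr1.
Qed.

Lemma inner_shiftl f g : inner (fun t => z t * f t) g = inner f (fun t => (z t)^-1 * g t).
Proof.
rewrite !innerE; congr cint; apply/funext => t.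
by rewrite conjcM -circle_pt_conj conjCK mulrCA mulrA.
Qed.

Lemma inner_shift f g : inner (fun t => z t * f t) (fun t => z t * g t) = inner f g.
Proof.
rewrite inner_shiftl; congr inner; apply/funext => t.
by rewrite mulrA mulVf ?mul1r// circle_pt_neq0.
Qed.

Lemma fourier_coef_inner1 f : fourier_coef f 0 = inner f (fun=> 1).
Proof. by rewrite /fourier_coef; congr inner; apply/funext => t; rewrite expr0z. Qed.

Lemma fourier_coef_shift f n : fourier_coef (fun t => z t * f t) n = fourier_coef f (n - 1).
Proof.
rewrite /fourier_coef inner_shiftl; congr inner; apply/funext => t.
by rewrite -exprN1 -expfzDr ?circle_pt_neq0// addrC.
Qed.

Lemma fourier_coef_unshift f n :
  fourier_coef (fun t => (z t)^-1 * f t) n = fourier_coef f (n + 1).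
Proof.
rewrite /fourier_coef -inner_shift; congr inner; apply/funext => t.
  by rewrite mulrA divff ?mul1r// circle_pt_neq0.
by rewrite expfzDr ?circle_pt_neq0// expr1z mulrC.
Qed.

Lemma fourier_coef_cst (c : C) n : fourier_coef (fun _ : R => c) n = (n == 0)%:R * c.
Proof.
rewrite /fourier_coef innerE.
have -> : (fun t => c * (z t ^ n)^*) = (fun t => c * z t ^ (- n)).
  by apply/funext => t; rewrite circle_ptX_conj.
rewrite cintZ ?cint_circle_ptX ?oppr_eq0 1?mulrC//.
exact: inL2_cintegrable (inL2_circle_ptX _).
Qed.

Lemma fourier_coefD f g n : inL2 f -> inL2 g ->
  fourier_coef (fun t => f t + g t) n = fourier_coef f n + fourier_coef g n.
Proof. by move=> fi gi; rewrite /fourier_coef innerDl//; exact: inL2_circle_ptX. Qed.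

Lemma fourier_coefZ c f n : inL2 f ->
  fourier_coef (fun t => c * f t) n = c * fourier_coef f n.
Proof. by move=> fi; rewrite /fourier_coef innerZl//; exact: inL2_circle_ptX. Qed.

Lemma H2_L2 f : H2 f -> inL2 f. Proof. by case. Qed.

Lemma H2D f g : H2 f -> H2 g -> H2 (fun t => f t + g t).
Proof.
move=> [fi f0] [gi g0]; split; first exact: inL2D.
by move=> n n0; rewrite fourier_coefD// f0// g0// addr0.
Qed.

Lemma H2Z c f : H2 f -> H2 (fun t => c * f t).
Proof.
move=> [fi f0]; split; first exact: inL2Z.
by move=> n n0; rewrite fourier_coefZ// f0// mulr0.
Qed.

Lemma H2B f g : H2 f -> H2 g -> H2 (fun t => f t - g t).
Proof. by move=> fH gH; under eq_fun do rewrite -mulN1r; apply: H2D => //; exact: H2Z. Qed.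

Lemma H2_cst (c : C) : H2 (fun _ : R => c).
Proof.
split; first exact: inL2_cst.
by move=> n n0; rewrite fourier_coef_cst lt_eqF// mul0r.
Qed.

Lemma H2_shift f : H2 f -> H2 (fun t => z t * f t).
Proof.
move=> [fi f0]; split; first exact: inL2_shift.
by move=> n n0; rewrite fourier_coef_shift f0// subr_lt0 (lt_trans n0).
Qed.

Lemma H2_shift_mean f : H2 f -> inner (fun t => z t * f t) (fun=> 1) = 0.
Proof. by move=> [fi f0]; rewrite -fourier_coef_inner1 fourier_coef_shift f0. Qed.

(** The backward shift (f - f(0)) / z; on H2, f(0) is the zeroth Fourier
    coefficient. *)
Definition backshift f (t : R) : C := (z t)^-1 * (f t - inner f (fun=> 1)).

Lemma backshiftK f t : z t * backshift f t = f t - inner f (fun=> 1).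
Proof. by rewrite /backshift mulrA divff ?mul1r// circle_pt_neq0. Qed.

Lemma H2_backshift f : H2 f -> H2 (backshift f).
Proof.
move=> [fi f0].
have fci : inL2 (fun t => f t - inner f (fun=> 1)) by apply: inL2B => //; exact: inL2_cst.
split; first exact: inL2_unshift.
move=> n n0; rewrite /backshift fourier_coef_unshift.
rewrite fourier_coefD//; last exact: inL2_cst.
rewrite fourier_coef_cst; have [n1|n1] := eqVneq (n + 1) 0.
  by rewrite n1 fourier_coef_inner1 mul1r subrr.
by rewrite mul0r addr0 f0// lt_neqAle n1 lezD1.
Qed.

End HardySpaceTheory.

(** * The model space and the compressed shift *)
Section ModelSpace.
Context {R : realType}.
Local Notation C := (R[i]).
Local Notation mu := (@circle_measure R).
Local Notation z := (@circle_pt R).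
Implicit Types f g h : R -> C.
Context (theta : C -> C).
Hypothesis theta_inner : inner_function theta.
Local Notation b := (boundary theta).
Local Notation K := (model_space theta).
Local Notation k := (k0 theta).
Local Notation k' := (k0_tilde theta).
Local Notation one := (fun _ : R => 1 : C).

Let theta_bounded : exists M : R, forall w : C, normc w < 1 -> normc (theta w) <= M.
Proof.
have [_ [M HM] _] := theta_inner; exists M => w w1.
by have : `|w| < 1; [rewrite normr_normc ltcR|move/HM; rewrite normr_normc lecR].
Qed.

Let theta_diff w : normc w < 1 -> exists d, cdifferentiable theta w d.
Proof.
have [H _ _] := theta_inner => w1; apply: derivable_cdifferentiable; apply: H.
by rewrite normr_normc ltcR.
Qed.

Let radial_cvg_ae : {ae mu, forall t, cvg (radial theta t r @[r --> (1 : R)^'-])}.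
Proof. by have [_ _] := theta_inner; apply: ae_imply => t []. Qed.

Let unimodular_ae : {ae mu, forall t, b t * (b t)^* = 1}.
Proof.
have [_ _] := theta_inner; apply: ae_imply => t [_].
by rewrite normr_normc mulc_conj => /(congr1 (@complex.Re R)) /= ->; rewrite expr1n.
Qed.

Let inL2_mul_b f : inL2 f -> inL2 (fun t => b t * f t).
Proof.
have [M bM] := theta_bounded.
exact: inL2_bmul (boundary_meas theta_diff) (boundary_bound bM).
Qed.

Let b1E : (fun t => b t * 1) = b.
Proof. by apply/funext => t; rewrite mulr1. Qed.

Let inL2_b : inL2 b.
Proof. by rewrite -b1E; apply: inL2_mul_b; exact: inL2_cst. Qed.

(** Multiplication by theta is an isometry because |theta| = 1 on the circle. *)
Lemma inner_mul_unimodular f g : inL2 f -> inL2 g ->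
  inner (fun t => b t * f t) (fun t => b t * g t) = inner f g.
Proof.
move=> fi gi; rewrite !innerE; apply: cint_ae.
- apply: cintegrable_meas (inL2_inner (inL2_mul_b fi) (inL2_mul_b gi)).
- apply: cintegrable_meas (inL2_inner fi gi).
- apply: ae_imply unimodular_ae => t bt.
  by rewrite conjcM mulrACA bt mul1r.
Qed.

(** For n <= 0 all coefficients of h of index n - 1, n - 2, ... vanish, so
    that the mean value property applies to h z^-n. For n < 0 it shows that
    theta h is in H2, and for n = 0 that (theta h)(0) = theta(0) h(0). *)
Lemma fourier_coef_mul_b h n : H2 h -> n <= 0 ->
  fourier_coef (fun t => b t * h t) n = theta 0 * fourier_coef h n.
Proof.
move=> [hi h0] n0; rewrite /fourier_coef !innerE; have [M bM] := theta_bounded.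
have zi := @inL2_circle_ptX R n.
rewrite -(boundary_mean_value theta_diff bM radial_cvg_ae (inL2_inner hi zi)).
  by congr cint; apply/funext => t; rewrite mulrA.
move=> m; rewrite (_ : 0 = fourier_coef h (n - m.+1%:Z)).
  rewrite /fourier_coef innerE; congr cint; apply/funext => t.
  by rewrite mulrCA !circle_ptX_conj opprB expfzDr ?circle_pt_neq0.
by rewrite h0// subr_lt0 (le_lt_trans n0).
Qed.

Lemma H2_mul_b h : H2 h -> H2 (fun t => b t * h t).
Proof.
move=> hH; split; first exact/inL2_mul_b/H2_L2.
move=> n n0; rewrite fourier_coef_mul_b// ?ltW//.
by case: hH => _ ->//; rewrite mulr0.
Qed.

Lemma mean_mul_b h : H2 h -> inner (fun t => b t * h t) one = theta 0 * inner h one.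
Proof. by move=> hH; rewrite -!fourier_coef_inner1 fourier_coef_mul_b. Qed.

Lemma H2_b : H2 b.
Proof. by rewrite -b1E; apply: H2_mul_b; exact: H2_cst. Qed.

Lemma inner11 : inner one one = 1.
Proof. by rewrite -fourier_coef_inner1 fourier_coef_cst eqxx mul1r. Qed.

Lemma mean_b : inner b one = theta 0.
Proof.
have := mean_mul_b (H2_cst 1); rewrite b1E => ->.
by rewrite inner11 mulr1.
Qed.

Lemma inner_b_mul h : inL2 h -> inner b (fun t => b t * h t) = inner one h.
Proof.
move=> hi; have := inner_mul_unimodular (inL2_cst 1) hi; by rewrite b1E.
Qed.

Lemma inner_bb : inner b b = 1.
Proof. by have := inner_b_mul (inL2_cst 1); rewrite b1E inner11. Qed.

Let L2one : inL2 one. Proof. exact: inL2_cst. Qed.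

Lemma model_space_H2 f : K f -> H2 f. Proof. by case. Qed.
Lemma model_space_L2 f : K f -> inL2 f. Proof. by case=> [[]]. Qed.

Lemma model_space_orth_b f : K f -> inner f b = 0.
Proof. by case=> _ /(_ _ (H2_cst 1)); rewrite b1E. Qed.

Lemma model_space_lin c f g : K f -> K g -> K (fun t => c * f t + g t).
Proof.
move=> [fH fo] [gH go]; split; first by apply: H2D => //; exact: H2Z.
move=> h hH; have bh := inL2_mul_b (H2_L2 hH).
rewrite innerDl ?innerZl ?fo ?go ?mulr0 ?addr0//; try exact: H2_L2.
by apply: inL2Z; exact: H2_L2.
Qed.

Let model_space_cst0 : K (fun=> 0).
Proof.
split; first exact: H2_cst.
move=> h hH; rewrite innerE; under eq_fun do rewrite mul0r; exact: cint0.
Qed.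

Lemma model_spaceZ c f : K f -> K (fun t => c * f t).
Proof.
move=> fK; have := model_space_lin c fK model_space_cst0.
by under eq_fun do rewrite addr0.
Qed.

Lemma model_spaceB f g : K f -> K g -> K (fun t => f t - g t).
Proof.
move=> fK gK; have := model_space_lin (-1) gK fK.
by under eq_fun do rewrite mulN1r addrC.
Qed.

Lemma model_space_k0 : K k.
Proof.
have bc : H2 (fun t => (theta 0)^* * b t) by exact/H2Z/H2_b.
split; first by apply: H2B => //; exact: H2_cst.
move=> h hH; have hi := H2_L2 hH; have bhi := inL2_mul_b hi.
rewrite innerBl// ?innerZl//; last exact: H2_L2.
rewrite inner_b_mul// (inner_conj bhi L2one) mean_mul_b// conjcM.
by rewrite (inner_conj hi L2one) subrr.
Qed.

(** Stated under orthogonality to z theta H2, so as to cover both f in the model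
    space, where it gives S*, and f = theta, where it gives k~. *)
Lemma model_space_backshift f : H2 f ->
  (forall h, H2 h -> inner f (fun t => b t * (z t * h t)) = 0) -> K (backshift f).
Proof.
move=> fH fo; have fi := H2_L2 fH; split; first exact: H2_backshift.
move=> h hH; have zhH := H2_shift hH.
rewrite -inner_shift.
have -> : (fun t => z t * (b t * h t)) = (fun t => b t * (z t * h t)).
  by apply/funext => t; rewrite mulrCA.
have -> : (fun t => z t * backshift f t) = (fun t => f t - inner f one).
  by apply/funext => t; rewrite backshiftK.
have bzh := inL2_mul_b (H2_L2 zhH).
rewrite innerBl//; last exact: inL2_cst.
rewrite fo// sub0r (_ : (fun _ : R => inner f one) = (fun t => inner f one * one t)).
  rewrite innerZl// (inner_conj bzh L2one) mean_mul_b// H2_shift_mean//.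
  by rewrite mulr0 conjC0 mulr0 oppr0.
by apply/funext => t; rewrite mulr1.
Qed.

Lemma k0_tildeE : k' = backshift b.
Proof. by apply/funext => t; rewrite /backshift mean_b mulrC. Qed.

Lemma model_space_k0_tilde : K k'.
Proof.
rewrite k0_tildeE; apply: model_space_backshift; first exact: H2_b.
move=> h hH; have zhH := H2_shift hH.
rewrite inner_b_mul ?(inner_conj (H2_L2 zhH) L2one); last exact: H2_L2.
by rewrite H2_shift_mean// conjC0.
Qed.

Let k_L2 : inL2 k. Proof. exact: model_space_L2 model_space_k0. Qed.
Let k'_L2 : inL2 k'. Proof. exact: model_space_L2 model_space_k0_tilde. Qed.

(** The reproducing property: k differs from 1 by a multiple of theta. *)
Lemma inner_k0 f : K f -> inner f k = inner f one.
Proof.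
move=> fK; have fi := model_space_L2 fK.
rewrite innerBr ?innerZr ?(model_space_orth_b fK) ?mulr0 ?subr0//.
exact: inL2Z.
Qed.

(** z k~ differs from theta by a constant, and z f has mean 0. *)
Lemma inner_k0_tilde f : K f -> inner f k' = inner (fun t => z t * f t) b.
Proof.
move=> fK; have fi := model_space_L2 fK.
rewrite k0_tildeE -inner_shift.
have -> : (fun t => z t * backshift b t) = (fun t => b t - theta 0 * one t).
  by apply/funext => t; rewrite backshiftK mean_b mulr1.
have zfi := inL2_shift fi.
rewrite innerBr// ?innerZr//; last exact: inL2Z.
by rewrite H2_shift_mean ?mulr0 ?subr0//; exact: model_space_H2.
Qed.

(** The difference f - g is then orthogonal to itself. *)
Lemma model_space_eq f g : K f -> K g -> (forall h, K h -> inner f h = inner g h) ->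
  ae_equal f g.
Proof.
move=> fK gK fg; have dK := model_spaceB fK gK.
have fi := model_space_L2 fK; have gi := model_space_L2 gK.
have di := model_space_L2 dK.
have : ae_equal (fun t => f t - g t) (fun=> 0).
  by apply: inner_definite => //; rewrite innerBl// fg// subrr.
by apply: ae_imply => t /eqP; rewrite subr_eq0 => /eqP.
Qed.

Local Notation S := (compressed_shift theta).
Local Notation T := (compressed_shift_adj theta).

(* The component of z f along theta H2 is along theta alone, since f is orthogonal
   to theta H2; its coefficient <z f, theta> is <f, k~>. *)
Let shift_formula f (t : R) : C := z t * f t - inner f k' * b t.

Let shift_formula_K f : K f -> K (shift_formula f).
Proof.
move=> fK; have fH := model_space_H2 fK; have fi := H2_L2 fH.
have cb : H2 (fun t => inner f k' * b t) by exact/H2Z/H2_b.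
split; first by apply: H2B => //; exact: H2_shift.
move=> h hH; have hi := H2_L2 hH; have bhi := inL2_mul_b hi.
have zfi := inL2_shift fi.
rewrite innerBl// ?innerZl//; last exact: H2_L2.
rewrite inner_b_mul// (inner_conj hi L2one).
have Bh := H2_backshift hH.
have bBh := inL2_mul_b (H2_L2 Bh).
have -> : (fun t => b t * h t) =
    (fun t => inner h one * b t + z t * (b t * backshift h t)).
  apply/funext => t; rewrite mulrCA backshiftK; ring.
rewrite innerDr// ?innerZr//; [|exact: inL2Z|exact: inL2_shift].
rewrite inner_shift -inner_k0_tilde//.
by have [_ ->//] := fK; rewrite addr0 mulrC subrr.
Qed.

Let shift_formula_orth f h : K f -> K h ->
  inner (fun t => z t * f t - shift_formula f t) h = 0.
Proof.
move=> fK hK; have hi := model_space_L2 hK.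
have -> : (fun t => z t * f t - shift_formula f t) = (fun t => inner f k' * b t).
  by apply/funext => t; rewrite /shift_formula; ring.
by rewrite innerZl// (inner_conj hi inL2_b) model_space_orth_b// conjC0 mulr0.
Qed.

Lemma compressed_shiftE f : K f ->
  K (S f) /\ ae_equal (S f) (fun t => z t * f t - inner f k' * b t).
Proof.
move=> fK; have FK := shift_formula_K fK.
have [SK So] : K (S f) /\ forall h, K h -> inner ((fun t => z t * f t) \- S f) h = 0.
  rewrite /compressed_shift /orth_proj.
  apply: (@xgetPex _ (fun=> 0) [set g | K g /\ forall h, K h ->
    inner ((fun t => z t * f t) \- g) h = 0]).
  by exists (shift_formula f); split => // h hK; exact: shift_formula_orth.
split => //; apply: model_space_eq => // h hK; have hi := model_space_L2 hK.
have zfi := inL2_shift (model_space_L2 fK).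
have := So _ hK; rewrite innerBl//; last exact: model_space_L2.
have := shift_formula_orth fK hK; rewrite innerBl//; last exact: model_space_L2.
by move=> /eqP; rewrite subr_eq0 => /eqP -> /eqP; rewrite subr_eq0 => /eqP ->.
Qed.

Lemma compressed_shift_K f : K f -> K (S f).
Proof. by move=> /compressed_shiftE[]. Qed.

Lemma compressed_shift_ae f g : K f -> K g -> ae_equal f g -> ae_equal (S f) (S g).
Proof.
move=> fK gK fg; have [_ Sf] := compressed_shiftE fK; have [_ Sg] := compressed_shiftE gK.
apply: ae_equal_trans Sf _; apply: ae_equal_trans (ae_equal_sym Sg).
have -> : inner f k' = inner g k' by apply: inner_ael fg => //; exact: model_space_L2.
by apply: ae_equalB; [exact: ae_equalM|exact: ae_equal_refl].
Qed.

Lemma compressed_shift_lin c f g : K f -> K g ->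
  ae_equal (S (fun t => c * f t + g t)) (fun t => c * S f t + S g t).
Proof.
move=> fK gK; have [_ Sfg] := compressed_shiftE (model_space_lin c fK gK).
have [_ Sf] := compressed_shiftE fK; have [_ Sg] := compressed_shiftE gK.
apply: ae_equal_trans Sfg _; apply: ae_equal_sym.
apply: ae_imply2 Sf Sg => t -> ->.
have fi := model_space_L2 fK; have gi := model_space_L2 gK.
by rewrite innerDl ?innerZl//; [ring|exact: inL2Z].
Qed.

Lemma inner_compressed_shift f g : K f -> K g ->
  inner (S f) g = inner (fun t => z t * f t) g.
Proof.
move=> fK gK; have [SK Sf] := compressed_shiftE fK.
have fi := model_space_L2 fK; have gi := model_space_L2 gK.
have zfi := inL2_shift fi; have cbi := inL2Z (inner f k') inL2_b.
have Fi : inL2 (fun t => z t * f t - inner f k' * b t) by exact: inL2B.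
rewrite (inner_ael (model_space_L2 SK) Fi gi Sf) innerBl// innerZl//.
by rewrite (inner_conj gi inL2_b) model_space_orth_b// conjC0 mulr0 subr0.
Qed.

Let backshift_adjoint f g : K f -> K g -> inner (S f) g = inner f (backshift g).
Proof.
move=> fK gK; rewrite inner_compressed_shift// -[RHS]inner_shift.
have fi := model_space_L2 fK; have gi := model_space_L2 gK.
have zfi := inL2_shift fi.
have -> : (fun t => z t * backshift g t) = (fun t => g t - inner g one * one t).
  by apply/funext => t; rewrite backshiftK mulr1.
rewrite innerBr ?innerZr//; last exact: inL2Z.
by rewrite H2_shift_mean ?mulr0 ?subr0//; exact: model_space_H2.
Qed.

Let backshift_K g : K g -> K (backshift g).
Proof.
move=> gK; apply: model_space_backshift; first exact: model_space_H2.
by move=> h hH; have [_] := gK; apply; exact: H2_shift.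
Qed.

Lemma compressed_shift_adjE g : K g ->
  [/\ K (T g), ae_equal (T g) (fun t => (z t)^-1 * (g t - inner g k)) &
      forall f, K f -> inner (S f) g = inner f (T g)].
Proof.
move=> gK.
have [TK Ta] : K (T g) /\ forall f, K f -> inner (S f) g = inner f (T g).
  rewrite /compressed_shift_adj /adjoint_on.
  apply: (@xgetPex _ (fun=> 0) [set g' | K g' /\ forall f, K f -> inner (S f) g = inner f g']).
  by exists (backshift g); split; [exact: backshift_K|move=> f fK; exact: backshift_adjoint].
split => //; rewrite inner_k0//.
have BK := backshift_K gK.
apply: model_space_eq => // h hK; have hi := model_space_L2 hK.
rewrite (inner_conj hi (model_space_L2 TK)) (inner_conj hi (model_space_L2 BK)).
by rewrite -Ta// backshift_adjoint.
Qed.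

Lemma compressed_shift_adj_K g : K g -> K (T g).
Proof. by move=> /compressed_shift_adjE[]. Qed.

Lemma compressed_shift_adjP f g : K f -> K g -> inner (S f) g = inner f (T g).
Proof. by move=> fK /compressed_shift_adjE[_ _]; exact. Qed.

(** S f has mean - <f, k~> theta(0), so that S* S f = f - <f, k~> (theta - theta(0)) / z. *)
Lemma shift_adj_shift f : K f ->
  ae_equal (T (S f)) (fun t => f t - inner f k' * k' t).
Proof.
move=> fK; have [SK Sf] := compressed_shiftE fK.
have [_ TSf _] := compressed_shift_adjE SK.
have fi := model_space_L2 fK; have zfi := inL2_shift fi.
have cbi := inL2Z (inner f k') inL2_b.
have Fi : inL2 (fun t => z t * f t - inner f k' * b t) by exact: inL2B.
have Sf0 : inner (S f) k = - (inner f k' * theta 0).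
  rewrite inner_k0// (inner_ael (model_space_L2 SK) Fi L2one Sf).
  rewrite innerBl// innerZl// mean_b H2_shift_mean ?sub0r//.
  exact: model_space_H2.
apply: ae_equal_trans TSf _; apply: ae_imply Sf => t ->; rewrite Sf0 /k0_tilde.
by field; exact: circle_pt_neq0.
Qed.

(** z S* f = f - <f, k>, and <S* f, k~> = <f - <f, k>, theta> = - <f, k> conj(theta(0)). *)
Lemma shift_shift_adj f : K f ->
  ae_equal (S (T f)) (fun t => f t - inner f k * k t).
Proof.
move=> fK; have [TK Tf _] := compressed_shift_adjE fK.
have [_ STf] := compressed_shiftE TK.
have fi := model_space_L2 fK.
have zT : ae_equal (fun t => z t * T f t) (fun t => f t - inner f k * one t).
  apply: ae_imply Tf => t ->; rewrite mulrA divff ?circle_pt_neq0// mul1r mulr1//.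
have TF0 : inner (T f) k' = - (inner f k * (theta 0)^*).
  have ci := inL2Z (inner f k) L2one.
  rewrite inner_k0_tilde// (inner_ael _ (inL2B fi ci) inL2_b zT).
    rewrite innerBl// innerZl// model_space_orth_b// sub0r.
    by rewrite (inner_conj inL2_b L2one) mean_b.
  exact/inL2_shift/model_space_L2.
apply: ae_equal_trans STf _; apply: ae_imply zT => t ->; rewrite TF0 /k0; ring.
Qed.

(** z k~ = theta - theta(0) and <k~, k~> = 1 - |theta(0)|^2. *)
Lemma compressed_shift_k0_tilde : ae_equal (S k') (fun t => - theta 0 * k t).
Proof.
have [_ Sk'] := compressed_shiftE model_space_k0_tilde.
have zk' : (fun t => z t * k' t) = (fun t => b t - theta 0 * one t).
  by apply/funext => t; rewrite k0_tildeE backshiftK mean_b mulr1.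
have kk : inner k' k' = 1 - theta 0 * (theta 0)^*.
  rewrite (inner_k0_tilde model_space_k0_tilde) zk'.
  rewrite innerBl ?innerZl ?inner_bb//; last exact: inL2Z.
  by rewrite (inner_conj inL2_b L2one) mean_b.
apply: ae_equal_trans Sk' _; apply: aeW => t.
rewrite kk; have := congr1 (fun F => F t) zk' => /= ->.
by rewrite /k0; ring.
Qed.

(** <k, k> = k(0) = 1 - |theta(0)|^2. *)
Lemma compressed_shift_adj_k0 : ae_equal (T k) (fun t => - (theta 0)^* * k' t).
Proof.
have [_ Tk _] := compressed_shift_adjE model_space_k0.
have kk : inner k k = 1 - (theta 0)^* * theta 0.
  rewrite (inner_k0 model_space_k0) innerBl ?innerZl ?inner11 ?mean_b//; exact: inL2Z.
apply: ae_equal_trans Tk _; apply: aeW => t.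
by rewrite kk /k0 /k0_tilde; field; exact: circle_pt_neq0.
Qed.

End ModelSpace.

(** * The two operator identities *)
Section OperatorIdentities.
Context {R : realType}.
Local Notation C := (R[i]).
Context (theta : C -> C) (A : (R -> C) -> (R -> C)).
Hypothesis theta_inner : inner_function theta.
Hypothesis A_bounded : bounded_linear_on (model_space theta) A.
Local Notation K := (model_space theta).
Local Notation S := (compressed_shift theta).
Local Notation T := (compressed_shift_adj theta).
Local Notation k := (k0 theta).
Local Notation k' := (k0_tilde theta).
Implicit Types f g : R -> C.

Let A_K f : K f -> K (A f). Proof. by case: A_bounded => + _ _ _; exact. Qed.
Let A_ae f g : K f -> K g -> ae_equal f g -> ae_equal (A f) (A g).
Proof. by case: A_bounded => _ + _ _; exact. Qed.
Let A_lin c f g : K f -> K g ->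
  ae_equal (A (fun t => c * f t + g t)) (fun t => c * A f t + A g t).
Proof. by case: A_bounded => _ _ + _; exact. Qed.
Let S_K f : K f -> K (S f). Proof. exact: compressed_shift_K. Qed.
Let T_K f : K f -> K (T f). Proof. exact: compressed_shift_adj_K. Qed.
Let k_K : K k. Proof. exact: model_space_k0. Qed.
Let k'_K : K k'. Proof. exact: model_space_k0_tilde. Qed.
Let K_L2 f : K f -> inL2 f. Proof. exact: model_space_L2. Qed.

Let k_L2 : inL2 k. Proof. exact: K_L2. Qed.
Let k'_L2 : inL2 k'. Proof. exact: K_L2. Qed.

(** The name refers to A - S A S*, the displacement of A in the theory of
    Toeplitz-like operators. *)
Definition displacement_identity (psi chi : R -> C) :=
  op_equal_on K (fun f => A f \- S (A (T f)))
                (fun f => rank_one psi k f \+ rank_one k chi f).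

Definition commutator_identity (u v : R -> C) :=
  op_equal_on K (fun f => A (S f) \- S (A f))
                (fun f => rank_one u k' f \+ rank_one k v f).

Lemma inner_shift_k0 f : K f -> inner (S f) k = - (theta 0 * inner f k').
Proof.
move=> fK; have fi := K_L2 fK; rewrite (compressed_shift_adjP theta_inner)//.
rewrite (inner_aer (K_L2 (T_K k_K)) _ fi (compressed_shift_adj_k0 theta_inner)).
  by rewrite innerZr// conjcN conjCK mulNr.
exact: inL2Z.
Qed.

Lemma inner_adj_k0_tilde f : K f -> inner (T f) k' = - ((theta 0)^* * inner f k).
Proof.
move=> fK; have fi := K_L2 fK; have Sk'i := K_L2 (S_K k'_K).
rewrite (inner_conj k'_L2 (K_L2 (T_K fK))).
rewrite -(compressed_shift_adjP theta_inner)// -inner_conj//.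
rewrite (inner_aer Sk'i _ fi (compressed_shift_k0_tilde theta_inner)).
  by rewrite innerZr// conjcN mulNr.
exact: inL2Z.
Qed.

(** The first identity is applied to S f. *)
Lemma displacement_to_commutator psi chi : K psi -> K chi ->
  displacement_identity psi chi ->
  let u := fun t => - (S (A k') t + theta 0 * psi t) in
  let v := T chi in
  [/\ K u, K v & commutator_identity u v].
Proof.
move=> psiK chiK id1 u v; split; [|exact: T_K|].
  have uK := model_space_lin theta_inner (theta 0) psiK (S_K (A_K k'_K)).
  have := model_spaceZ theta_inner (-1) uK.
  by under eq_fun do rewrite mulN1r addrC.
move=> f fK; have SfK := S_K fK; have TSfK := T_K SfK.
set c := inner f k'.
have cK : K (fun t => - c * k' t + f t) by exact: model_space_lin.
have TS : ae_equal (T (S f)) (fun t => - c * k' t + f t).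
  by apply: ae_imply (shift_adj_shift theta_inner fK) => t ->; rewrite /c; ring.
have ATS : ae_equal (A (T (S f))) (fun t => - c * A k' t + A f t).
  exact: ae_equal_trans (A_ae TSfK cK TS) (A_lin _ k'_K fK).
have AcK : K (fun t => - c * A k' t + A f t) by apply: model_space_lin => //; exact: A_K.
have SATS : ae_equal (S (A (T (S f)))) (fun t => - c * S (A k') t + S (A f) t).
  apply: ae_equal_trans (compressed_shift_lin theta_inner _ (A_K k'_K) (A_K fK)).
  by apply: compressed_shift_ae => //; exact: A_K.
apply: ae_imply2 SATS (id1 _ SfK) => t /= St.
rewrite /rank_one /= inner_shift_k0// (compressed_shift_adjP theta_inner)// St -/c => E.
rewrite -[A (S f) t](subrK (- c * S (A k') t + S (A f) t)) E /u /v; ring.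
Qed.

(** The second identity is applied to S* f. *)
Lemma commutator_to_displacement u v : K u -> K v ->
  commutator_identity u v ->
  let psi := fun t => A k t - (theta 0)^* * u t in
  let chi := S v in
  [/\ K psi, K chi & displacement_identity psi chi].
Proof.
move=> uK vK id2 psi chi; split; [|exact: S_K|].
  apply: model_spaceB => //; first exact: A_K.
  exact: model_spaceZ.
move=> f fK; have TfK := T_K fK; have STfK := S_K TfK.
set c := inner f k.
have cK : K (fun t => - c * k t + f t) by exact: model_space_lin.
have ST : ae_equal (S (T f)) (fun t => - c * k t + f t).
  by apply: ae_imply (shift_shift_adj theta_inner fK) => t ->; rewrite /c; ring.
have AST : ae_equal (A (S (T f))) (fun t => - c * A k t + A f t).
  exact: ae_equal_trans (A_ae STfK cK ST) (A_lin _ k_K fK).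
have Tv : inner (T f) v = inner f (S v).
  rewrite (inner_conj (K_L2 vK) (K_L2 TfK)) -(compressed_shift_adjP theta_inner)//.
  by rewrite -inner_conj//; [exact/K_L2/S_K|exact: K_L2].
apply: ae_imply2 AST (id2 _ TfK) => t /= At.
rewrite /rank_one /= inner_adj_k0_tilde// Tv At -/c => E.
rewrite -[S (A (T f)) t](subKr (- c * A k t + A f t)) E /psi /chi; ring.
Qed.

End OperatorIdentities.

Theorem lemma5p1 (R : realType) (theta : R[i] -> R[i])
    (A : (R -> R[i]) -> (R -> R[i])) :
  inner_function theta -> ~ constant_on_disk theta ->
  bounded_linear_on (model_space theta) A ->
  let K := model_space theta in
  let S := compressed_shift theta in
  let Sadj := compressed_shift_adj theta in
  let k := k0 theta in
  let k' := k0_tilde theta in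
  let identity1 (psi chi : R -> R[i]) :=
    op_equal_on K (fun f => A f \- S (A (Sadj f)))
                  (fun f => rank_one psi k f \+ rank_one k chi f) in
  let identity2 (u v : R -> R[i]) :=
    op_equal_on K (fun f => A (S f) \- S (A f))
                  (fun f => rank_one u k' f \+ rank_one k v f) in
  [/\ (exists psi chi, [/\ K psi, K chi & identity1 psi chi]) <->
      (exists u v, [/\ K u, K v & identity2 u v]),
      forall psi chi, K psi -> K chi -> identity1 psi chi ->
        let u := fun t => - (S (A k') t + theta 0 * psi t) in
        let v := Sadj chi in
        [/\ K u, K v & identity2 u v] &
      forall u v, K u -> K v -> identity2 u v ->
        let psi := fun t => A k t - (theta 0)^* * u t in
        let chi := S v in
        [/\ K psi, K chi & identity1 psi chi]].
Proof.
move=> theta_inner _ A_bounded K S Sadj k k' identity1 identity2.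
have fwd := displacement_to_commutator theta_inner A_bounded.
have bwd := commutator_to_displacement theta_inner A_bounded.
split; [split|exact: fwd|exact: bwd].
- move=> [psi [chi [psiK chiK id1]]].
  by have [uK vK id2] := fwd psi chi psiK chiK id1; do 2 eexists; split; [exact: uK|exact: vK|].
- move=> [u [v [uK vK id2]]].
  by have [pK cK id1] := bwd u v uK vK id2; do 2 eexists; split; [exact: pK|exact: cK|].
Qed.
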